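(* Let $S,T$ be as in the context and let $\mathrm{Pr}_T(x)$ be any $\Sigma_1$ provability predicate of $T$. Then: 1. If $\mathrm{Pr}_T(x)$ satisfies $\mathbf{E}$, $\mathbf{C}$ and $\mathbf{D3}$, then $T\nvdash\mathrm{Con}^{\mathrm{L}}_T$. 2. If $\mathrm{Pr}_T(x)$ satisfies $\mathbf{C}$ and $\mathbf{\Sigma_1C}^-$, then $\mathrm{Pr}_T(x)$ does not satisfy $\mathbf{Ros}$.
   Context: $\mathcal{L}_A=\{0,\mathsf{s},+,\times,\leq\}$ is the language of first-order arithmetic, and ''formula'' means $\mathcal{L}_A$-formula; $\ulcorner\varphi\urcorner$ is the numeral of the Gödel number of $\varphi$. $\Sigma_1$ formulas are those of the form $\exists\vec{x}\,\delta$ with $\delta$ a $\Delta_0$ formula. $S$ and $T$ are consistent c.e. extensions of Peano Arithmetic $\mathsf{PA}$ in the language $\mathcal{L}_A$ such that $T$ is stronger than $S$ (every theorem of $S$ is a theorem of $T$; $S=T$ is allowed). A formula $\mathrm{Pr}_T(x)$ is a provability predicate of $T$ if for every formula $\varphi$: $T\vdash\varphi$ if and only if $S\vdash\mathrm{Pr}_T(\ulcorner\varphi\urcorner)$. A $\Sigma_1$ provability predicate is one that is a $\Sigma_1$ formula. $\mathrm{Con}^{\mathrm{L}}_T :\equiv \neg\,\mathrm{Pr}_T(\ulcorner 0=1\urcorner)$. Conditions on $\mathrm{Pr}_T(x)$: - $\mathbf{E}$: for all formulas $\varphi,\psi$, if $T\vdash\varphi\leftrightarrow\psi$, then $S\vdash\mathrm{Pr}_T(\ulcorner\varphi\urcorner)\leftrightarrow\mathrm{Pr}_T(\ulcorner\psi\urcorner)$.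 - $\mathbf{C}$: $S\vdash\mathrm{Pr}_T(\ulcorner\varphi\urcorner)\land\mathrm{Pr}_T(\ulcorner\psi\urcorner)\to\mathrm{Pr}_T(\ulcorner\varphi\land\psi\urcorner)$ for all formulas $\varphi,\psi$. - $\mathbf{D3}$: $S\vdash\mathrm{Pr}_T(\ulcorner\varphi\urcorner)\to\mathrm{Pr}_T(\ulcorner\mathrm{Pr}_T(\ulcorner\varphi\urcorner)\urcorner)$ for every formula $\varphi$. - $\mathbf{\Sigma_1C}^-$: there is a finite subtheory $T_0$ of $T$ (a finite set of sentences that are theorems of $T$) such that for every $\Sigma_1$ sentence $\varphi$, $S\vdash\varphi\to\mathrm{Pr}_T(\ulcorner\bigwedge T_0\to\varphi\urcorner)$; by convention $\bigwedge\emptyset$ is $0=0$. - $\mathbf{Ros}$: for every formula $\varphi$, if $T\vdash\neg\varphi$, then $T\vdash\neg\,\mathrm{Pr}_T(\ulcorner\varphi\urcorner)$. *)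

(* Defs.v *)
From Stdlib Require Import List Arith Cantor.
Import ListNotations.

(** Variables are de Bruijn indices. *)

Inductive term : Type :=
| tVar (i : nat)
| tZero
| tSucc (t : term)
| tPlus (t u : term)
| tMult (t u : term).

Inductive form : Type :=
| fEq (t u : term)
| fLe (t u : term)
| fNeg (p : form)
| fAnd (p q : form)
| fOr (p q : form)
| fImp (p q : form)
| fAll (p : form)
| fEx (p : form).

Definition fIff (p q : form) : form := fAnd (fImp p q) (fImp q p).

Definition scons (t : term) (s : nat -> term) (i : nat) : term :=
  match i with 0 => t | S j => s j end.

Fixpoint tsubst (s : nat -> term) (t : term) : term :=
  match t with
  | tVar i => s i
  | tZero => tZero
  | tSucc t => tSucc (tsubst s t)
  | tPlus t u => tPlus (tsubst s t) (tsubst s u)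
  | tMult t u => tMult (tsubst s t) (tsubst s u)
  end.

Definition tshift : term -> term := tsubst (fun i => tVar (S i)).

Definition up (s : nat -> term) : nat -> term :=
  scons (tVar 0) (fun i => tshift (s i)).

Fixpoint fsubst (s : nat -> term) (p : form) : form :=
  match p with
  | fEq t u => fEq (tsubst s t) (tsubst s u)
  | fLe t u => fLe (tsubst s t) (tsubst s u)
  | fNeg p => fNeg (fsubst s p)
  | fAnd p q => fAnd (fsubst s p) (fsubst s q)
  | fOr p q => fOr (fsubst s p) (fsubst s q)
  | fImp p q => fImp (fsubst s p) (fsubst s q)
  | fAll p => fAll (fsubst (up s) p)
  | fEx p => fEx (fsubst (up s) p)
  end.

Definition fshift : form -> form := fsubst (fun i => tVar (S i)).

(** [inst p t] is p(t): variable 0 becomes [t], the others move down by one. *)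
Definition inst (p : form) (t : term) : form := fsubst (scons t tVar) p.

(** [form_below k p]: the free variables of [p] are among 0, ..., k-1. *)
Fixpoint term_below (k : nat) (t : term) : Prop :=
  match t with
  | tVar i => i < k
  | tZero => True
  | tSucc t => term_below k t
  | tPlus t u | tMult t u => term_below k t /\ term_below k u
  end.

Fixpoint form_below (k : nat) (p : form) : Prop :=
  match p with
  | fEq t u | fLe t u => term_below k t /\ term_below k u
  | fNeg p => form_below k p
  | fAnd p q | fOr p q | fImp p q => form_below k p /\ form_below k q
  | fAll p | fEx p => form_below (S k) p
  end.

Definition sentence (p : form) : Prop := form_below 0 p.

(** The shift of the bound [t] expresses that the quantified variable does not
    occur in it. *)
Inductive Delta0 : form -> Prop :=
| D0_eq t u : Delta0 (fEq t u)
| D0_le t u : Delta0 (fLe t u)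
| D0_neg p : Delta0 p -> Delta0 (fNeg p)
| D0_and p q : Delta0 p -> Delta0 q -> Delta0 (fAnd p q)
| D0_or p q : Delta0 p -> Delta0 q -> Delta0 (fOr p q)
| D0_imp p q : Delta0 p -> Delta0 q -> Delta0 (fImp p q)
| D0_all t p : Delta0 p -> Delta0 (fAll (fImp (fLe (tVar 0) (tshift t)) p))
| D0_ex t p : Delta0 p -> Delta0 (fEx (fAnd (fLe (tVar 0) (tshift t)) p)).

Inductive Sigma1 : form -> Prop :=
| S1_delta p : Delta0 p -> Sigma1 p
| S1_ex p : Sigma1 p -> Sigma1 (fEx p).

Inductive ded : list form -> form -> Prop :=
| ded_hyp G p : In p G -> ded G p
| ded_negI G p q : ded (p :: G) q -> ded (p :: G) (fNeg q) -> ded G (fNeg p)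
| ded_raa G p q : ded (fNeg p :: G) q -> ded (fNeg p :: G) (fNeg q) -> ded G p
| ded_andI G p q : ded G p -> ded G q -> ded G (fAnd p q)
| ded_andE1 G p q : ded G (fAnd p q) -> ded G p
| ded_andE2 G p q : ded G (fAnd p q) -> ded G q
| ded_orI1 G p q : ded G p -> ded G (fOr p q)
| ded_orI2 G p q : ded G q -> ded G (fOr p q)
| ded_orE G p q r :
    ded G (fOr p q) -> ded (p :: G) r -> ded (q :: G) r -> ded G r
| ded_impI G p q : ded (p :: G) q -> ded G (fImp p q)
| ded_impE G p q : ded G (fImp p q) -> ded G p -> ded G q
| ded_allI G p : ded (map fshift G) p -> ded G (fAll p)
| ded_allE G p t : ded G (fAll p) -> ded G (inst p t)
| ded_exI G p t : ded G (inst p t) -> ded G (fEx p)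
| ded_exE G p q :
    ded G (fEx p) -> ded (p :: map fshift G) (fshift q) -> ded G q
| ded_eqI G t : ded G (fEq t t)
| ded_eqE G p t u : ded G (fEq t u) -> ded G (inst p t) -> ded G (inst p u).

(** A theory is given by its set of axioms, which are sentences. *)
Definition proves (T : form -> Prop) (p : form) : Prop :=
  exists G, (forall q, In q G -> T q) /\ ded G p.

Definition consistent (T : form -> Prop) : Prop :=
  ~ exists p, proves T p /\ proves T (fNeg p).

Definition stronger (T S : form -> Prop) : Prop :=
  forall p, proves S p -> proves T p.

(** In the induction step, [p] is instantiated at the successor of variable 0,
    the parameters being left in place. *)
Definition induction (p : form) : form :=
  fImp (fAnd (inst p tZero)
             (fAll (fImp p (fsubst (scons (tSucc (tVar 0))
                                          (fun i => tVar (S i))) p))))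
       (fAll p).

Inductive PA : form -> Prop :=
| PA_succ_neq0 : PA (fAll (fNeg (fEq (tSucc (tVar 0)) tZero)))
| PA_succ_inj :
    PA (fAll (fAll (fImp (fEq (tSucc (tVar 1)) (tSucc (tVar 0)))
                         (fEq (tVar 1) (tVar 0)))))
| PA_plus0 : PA (fAll (fEq (tPlus (tVar 0) tZero) (tVar 0)))
| PA_plusS :
    PA (fAll (fAll (fEq (tPlus (tVar 1) (tSucc (tVar 0)))
                        (tSucc (tPlus (tVar 1) (tVar 0))))))
| PA_mult0 : PA (fAll (fEq (tMult (tVar 0) tZero) tZero))
| PA_multS :
    PA (fAll (fAll (fEq (tMult (tVar 1) (tSucc (tVar 0)))
                        (tPlus (tMult (tVar 1) (tVar 0)) (tVar 1)))))
| PA_le :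
    PA (fAll (fAll (fIff (fLe (tVar 1) (tVar 0))
                         (fEx (fEq (tPlus (tVar 0) (tVar 2)) (tVar 1))))))
| PA_induction k p :
    sentence (Nat.iter k fAll (induction p)) ->
    PA (Nat.iter k fAll (induction p)).

Fixpoint numeral (n : nat) : term :=
  match n with 0 => tZero | S m => tSucc (numeral m) end.

Definition node (tag a b : nat) : nat := to_nat (tag, to_nat (a, b)).
Arguments node : simpl never.

Fixpoint tcode (t : term) : nat :=
  match t with
  | tVar i => node 0 i 0
  | tZero => node 1 0 0
  | tSucc t => node 2 (tcode t) 0
  | tPlus t u => node 3 (tcode t) (tcode u)
  | tMult t u => node 4 (tcode t) (tcode u)
  end.

Fixpoint gnum (p : form) : nat :=
  match p with
  | fEq t u => node 0 (tcode t) (tcode u)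
  | fLe t u => node 1 (tcode t) (tcode u)
  | fNeg p => node 2 (gnum p) 0
  | fAnd p q => node 3 (gnum p) (gnum q)
  | fOr p q => node 4 (gnum p) (gnum q)
  | fImp p q => node 5 (gnum p) (gnum q)
  | fAll p => node 6 (gnum p) 0
  | fEx p => node 7 (gnum p) 0
  end.

Lemma node_inj a b c a' b' c' :
  node a b c = node a' b' c' -> a = a' /\ b = b' /\ c = c'.
Proof.
  unfold node; intros H.
  apply to_nat_inj, pair_equal_spec in H as [-> H].
  apply to_nat_inj, pair_equal_spec in H as [-> ->]. auto.
Qed.

Lemma tcode_inj t u : tcode t = tcode u -> t = u.
Proof.
  revert u; induction t; intros [] H; cbn in H;
    apply node_inj in H as (H1 & H2 & H3); try discriminate;
    f_equal; auto.
Qed.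

Lemma gnum_inj p q : gnum p = gnum q -> p = q.
Proof.
  revert q; induction p; intros [] H; cbn in H;
    apply node_inj in H as (H1 & H2 & H3); try discriminate;
    f_equal; auto using tcode_inj.
Qed.

Definition quote (p : form) : term := numeral (gnum p).

Inductive recfun : Type :=
| rZero
| rSucc
| rProj (i : nat)
| rComp (f : recfun) (gs : list recfun)
| rRec (f g : recfun)
| rMu (f : recfun).

(** [eval f v n]: the partial function [f] is defined at [v] with value [n]. *)
Inductive eval : recfun -> list nat -> nat -> Prop :=
| ev_zero v : eval rZero v 0
| ev_succ n v : eval rSucc (n :: v) (S n)
| ev_proj i v n : nth_error v i = Some n -> eval (rProj i) v n
| ev_comp f gs v ws n :
    Forall2 (fun g w => eval g v w) gs ws -> eval f ws n ->
    eval (rComp f gs) v n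
| ev_rec0 f g v n : eval f v n -> eval (rRec f g) (0 :: v) n
| ev_recS f g v k r n :
    eval (rRec f g) (k :: v) r -> eval g (k :: r :: v) n ->
    eval (rRec f g) (S k :: v) n
| ev_mu f v n :
    eval f (n :: v) 0 ->
    (forall k, k < n -> exists m, eval f (k :: v) (S m)) ->
    eval (rMu f) v n.

Definition ce (P : nat -> Prop) : Prop :=
  exists f, forall n, P n <-> exists m, eval f [n] m.

Definition ce_theory (T : form -> Prop) : Prop :=
  (forall p, T p -> sentence p) /\ ce (fun n => exists p, T p /\ gnum p = n).

(** Pr_T(x) is a formula whose only free variable is x, here variable 0. *)
Definition provability_predicate (S T : form -> Prop) (Pr : form) : Prop :=
  form_below 1 Pr /\
  forall p, proves T p <-> proves S (inst Pr (quote p)).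

Definition ConL (Pr : form) : form :=
  fNeg (inst Pr (quote (fEq tZero (tSucc tZero)))).

Definition cond_E (S T : form -> Prop) (Pr : form) : Prop :=
  forall p q, proves T (fIff p q) ->
    proves S (fIff (inst Pr (quote p)) (inst Pr (quote q))).

Definition cond_C (S : form -> Prop) (Pr : form) : Prop :=
  forall p q,
    proves S (fImp (fAnd (inst Pr (quote p)) (inst Pr (quote q)))
                   (inst Pr (quote (fAnd p q)))).

Definition cond_D3 (S : form -> Prop) (Pr : form) : Prop :=
  forall p,
    proves S (fImp (inst Pr (quote p))
                   (inst Pr (quote (inst Pr (quote p))))).

Fixpoint bigand (l : list form) : form :=
  match l with
  | [] => fEq tZero tZero
  | [p] => p
  | p :: l' => fAnd p (bigand l')
  end.

Definition cond_Sigma1C_minus (S T : form -> Prop) (Pr : form) : Prop :=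
  exists T0 : list form,
    NoDup T0 /\ (forall q, In q T0 -> sentence q /\ proves T q) /\
    forall p, Sigma1 p -> sentence p ->
      proves S (fImp p (inst Pr (quote (fImp (bigand T0) p)))).

Definition cond_Ros (T : form -> Prop) (Pr : form) : Prop :=
  forall p, proves T (fNeg p) -> proves T (fNeg (inst Pr (quote p))).

(* Main.v *)
From Stdlib Require Import List Arith Lia Cantor Classical.
Require Import Defs.
Import ListNotations.

(** Both parts use one Sigma1 sentence s with PA |- s <-> Pr(g), where
    g is ~(th -> s) for a theorem th of T.  If T refutes s, then T proves g, so
    S proves Pr(g), hence s, which contradicts the consistency of T.
    - Part 1 (th is 0 = 0): T proves g <-> ~Pr(g), so by D3, E and C, s implies
      Pr(g /\ ~g) and hence Pr(0 = 1); thus Con_T refutes s.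
    - Part 2 (th is the conjunction of T_0): s implies Pr(th -> s) by Sigma1C^-
      and Pr(~(th -> s)) by the choice of s, so by C it implies Pr of a
      contradiction, which T refutes by Ros.

    For the fixed point, the graph of the diagonal function is defined in the
    standard model by [exists z, y <= z /\ Q(y,z,x)] with Q a Delta0 formula.
    Adding to Q the clause "no smaller witness gives another value" makes the
    value at each numeral provably unique, by Delta0-completeness alone; no
    property of sequence coding has to be proved inside PA. *)

(** * Substitution *)

Lemma tsubst_ext s r t : (forall i, s i = r i) -> tsubst s t = tsubst r t.
Proof. intros H; induction t; cbn; congruence. Qed.

Lemma up_ext s r : (forall i, s i = r i) -> forall i, up s i = up r i.
Proof. intros H [|i]; cbn; congruence. Qed.

Lemma fsubst_ext p : forall s r,
  (forall i, s i = r i) -> fsubst s p = fsubst r p.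
Proof.
  induction p; intros s r H; cbn; f_equal; auto using tsubst_ext, up_ext.
Qed.

Lemma tsubst_comp s r t :
  tsubst s (tsubst r t) = tsubst (fun i => tsubst s (r i)) t.
Proof. induction t; cbn; congruence. Qed.

Lemma up_comp s r i :
  tsubst (up s) (up r i) = up (fun j => tsubst s (r j)) i.
Proof.
  destruct i as [|i]; [reflexivity|]; cbn; unfold tshift.
  now rewrite !tsubst_comp.
Qed.

Lemma fsubst_comp p : forall s r,
  fsubst s (fsubst r p) = fsubst (fun i => tsubst s (r i)) p.
Proof.
  induction p; intros s r; cbn; rewrite ?tsubst_comp; f_equal; auto.
  - rewrite IHp; apply fsubst_ext, up_comp.
  - rewrite IHp; apply fsubst_ext, up_comp.
Qed.

Lemma tsubst_id s t : (forall i, s i = tVar i) -> tsubst s t = t.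
Proof. intros H; induction t; cbn; congruence. Qed.

Lemma fsubst_id p : forall s, (forall i, s i = tVar i) -> fsubst s p = p.
Proof.
  assert (U : forall s, (forall i, s i = tVar i) -> forall i, up s i = tVar i)
    by (intros s H [|i]; cbn; [|rewrite H]; reflexivity).
  induction p; intros s H; cbn; f_equal; auto using tsubst_id.
Qed.

Lemma tsubst_scons_tshift t s u : tsubst (scons t s) (tshift u) = tsubst s u.
Proof. unfold tshift; rewrite tsubst_comp; now apply tsubst_ext. Qed.

Lemma tinst_tshift t u : tsubst (scons t tVar) (tshift u) = u.
Proof. rewrite tsubst_scons_tshift; now apply tsubst_id. Qed.

Lemma tsubst_up_tshift s t : tsubst (up s) (tshift t) = tshift (tsubst s t).
Proof. unfold tshift; rewrite !tsubst_comp; now apply tsubst_ext. Qed.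

Lemma inst_up s p t : inst (fsubst (up s) p) t = fsubst (scons t s) p.
Proof.
  unfold inst; rewrite fsubst_comp; apply fsubst_ext; intros [|i]; cbn;
    [reflexivity|apply tinst_tshift].
Qed.

(** After an existential formula is eliminated, it is reintroduced with the fresh variable 0 as its
    witness; this identity returns the original body. *)
Lemma inst_up_shift_var0 p :
  inst (fsubst (up (fun i => tVar (S i))) p) (tVar 0) = p.
Proof. rewrite inst_up; apply fsubst_id; now intros [|i]. Qed.

Lemma tsubst_numeral s n : tsubst s (numeral n) = numeral n.
Proof. induction n; cbn; congruence. Qed.

Lemma tshift_numeral n : tshift (numeral n) = numeral n.
Proof. apply tsubst_numeral. Qed.

Lemma tsubst_below k s r t : term_below k t ->
  (forall i, i < k -> s i = r i) -> tsubst s t = tsubst r t.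
Proof.
  intros B H; induction t; cbn in *; f_equal; auto; tauto.
Qed.

Lemma fsubst_below p : forall k s r, form_below k p ->
  (forall i, i < k -> s i = r i) -> fsubst s p = fsubst r p.
Proof.
  assert (U : forall k s r, (forall i, i < k -> s i = r i) ->
                            forall i, i < S k -> up s i = up r i).
  { intros k s r H [|i] Hi; cbn; [|rewrite H by lia]; reflexivity. }
  induction p; intros k s r B H; cbn in *; f_equal;
    try (eapply tsubst_below; [|exact H]; tauto);
    try (eapply IHp; [|apply U, H]; assumption);
    try (eapply IHp, H; tauto); try (eapply IHp1, H; tauto);
    try (eapply IHp2, H; tauto).
Qed.

Lemma fsubst_sentence s p : sentence p -> fsubst s p = p.
Proof.
  intros H; transitivity (fsubst tVar p); [|now apply fsubst_id].
  apply (fsubst_below p 0); [assumption|lia].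
Qed.

Lemma term_below_mono j k t : j <= k -> term_below j t -> term_below k t.
Proof. intros L; induction t; cbn; intuition lia. Qed.

Lemma form_below_mono p : forall j k,
  j <= k -> form_below j p -> form_below k p.
Proof.
  induction p; cbn; intros j k L H; intuition eauto using term_below_mono;
    (eapply IHp; [|exact H]; lia).
Qed.

Lemma term_below_tshift k t : term_below k t -> term_below (S k) (tshift t).
Proof. induction t; cbn; intuition lia. Qed.

Lemma term_below_numeral k n : term_below k (numeral n).
Proof. now induction n. Qed.

Lemma term_below_tsubst k s t :
  (forall i, term_below k (s i)) -> term_below k (tsubst s t).
Proof. intros H; induction t; cbn; auto. Qed.

Lemma form_below_fsubst p : forall k s,
  (forall i, term_below k (s i)) -> form_below k (fsubst s p).
Proof.
  assert (U : forall k s, (forall i, term_below k (s i)) ->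
                          forall i, term_below (S k) (up s i)).
  { intros k s H [|i]; cbn; [lia|apply term_below_tshift, H]. }
  induction p; cbn; intros k s H; auto using term_below_tsubst.
Qed.

Lemma form_below_inst k p t :
  form_below (S k) p -> term_below k t -> form_below k (inst p t).
Proof.
  intros Hp Ht; unfold inst.
  (* [form_below_fsubst] wants every image below [k], but [scons t tVar] sends large indices to
     large variables. Those indices do not occur free in [p], so they may be sent to [tZero]. *)
  rewrite (fsubst_below p (S k) _
             (fun i => if i <? S k then scons t tVar i else tZero)).
  - apply form_below_fsubst; intros i.
    destruct (Nat.ltb_spec i (S k)); [|exact I].
    destruct i as [|i]; cbn; [assumption|lia].
  - assumption.
  - intros i Hi; now rewrite (proj2 (Nat.ltb_lt i (S k)) Hi).
Qed.

Lemma Delta0_fsubst p : Delta0 p -> forall s, Delta0 (fsubst s p).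
Proof.
  induction 1; intros s; cbn; try (constructor; auto; fail).
  - rewrite tsubst_up_tshift; constructor; auto.
  - rewrite tsubst_up_tshift; constructor; auto.
Qed.

(** * Derivability from a theory *)

(** The open hypotheses [G] are kept apart from the finitely many axioms [L], so that the rules act
    on [G] alone. With [G] empty this is [proves] by conversion. *)
Definition entails (T : form -> Prop) (G : list form) (p : form) : Prop :=
  exists L, (forall q, In q L -> T q) /\ ded (G ++ L) p.

Lemma ded_weaken G p : ded G p -> forall H, incl G H -> ded H p.
Proof.
  induction 1; intros K I;
    assert (J : forall a, incl (a :: G) (a :: K))
      by (intros a x [|]; [left|right]; auto);
    try (econstructor; eauto; fail).
  - apply ded_allI, IHded, incl_map, I.
  - eapply ded_exE; [apply IHded1, I|].
    apply IHded2; intros x [|Hx]; [now left|right].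
    now apply (incl_map fshift I).
Qed.

Section Entails.
Variable T : form -> Prop.
Implicit Types (G : list form) (p q r : form).
Local Notation "G ⊢ p" := (entails T G p) (at level 70).

Lemma entails_weaken G H p : incl G H -> G ⊢ p -> H ⊢ p.
Proof.
  intros I (L & HL & D); exists L; split; [assumption|].
  apply (ded_weaken _ _ D), incl_app_app; [assumption|apply incl_refl].
Qed.

Lemma entails_ded G G' p q :
  (forall L, ded (G ++ L) p -> ded (G' ++ L) q) -> G ⊢ p -> G' ⊢ q.
Proof. intros K (L & HL & D); exists L; auto. Qed.

(** The premises may use different axioms; both are weakened to the concatenation of the two
    lists. *)
Lemma entails_ded2 G1 G2 G p1 p2 q :
  (forall L, ded (G1 ++ L) p1 -> ded (G2 ++ L) p2 -> ded (G ++ L) q) ->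
  G1 ⊢ p1 -> G2 ⊢ p2 -> G ⊢ q.
Proof.
  intros K (L1 & H1 & D1) (L2 & H2 & D2); exists (L1 ++ L2); split.
  - intros x [|]%in_app_or; auto.
  - apply K; [apply (ded_weaken _ _ D1)|apply (ded_weaken _ _ D2)];
      intros x; rewrite !in_app_iff; tauto.
Qed.

Lemma entails_axiom G p : T p -> G ⊢ p.
Proof.
  intros H; exists [p]; split; [now intros q [<-|[]]|].
  apply ded_hyp, in_or_app; cbn; auto.
Qed.

Lemma entails_hyp G p : In p G -> G ⊢ p.
Proof.
  intros H; exists []; split; [intros q []|].
  apply ded_hyp, in_or_app; auto.
Qed.

Lemma entails_impI G p q : p :: G ⊢ q -> G ⊢ fImp p q.
Proof. apply entails_ded; intros L; apply ded_impI. Qed.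

Lemma entails_impE G p q : G ⊢ fImp p q -> G ⊢ p -> G ⊢ q.
Proof. apply entails_ded2; intros L; apply ded_impE. Qed.

Lemma entails_negI G p q : p :: G ⊢ q -> p :: G ⊢ fNeg q -> G ⊢ fNeg p.
Proof. apply entails_ded2; intros L; apply ded_negI. Qed.

Lemma entails_raa G p q :
  fNeg p :: G ⊢ q -> fNeg p :: G ⊢ fNeg q -> G ⊢ p.
Proof. apply entails_ded2; intros L; apply ded_raa. Qed.

Lemma entails_absurd G p q : G ⊢ p -> G ⊢ fNeg p -> G ⊢ q.
Proof.
  apply entails_ded2; intros L H K; apply ded_raa with p;
    eapply ded_weaken; eauto; intros x; cbn; auto.
Qed.

Lemma entails_andI G p q : G ⊢ p -> G ⊢ q -> G ⊢ fAnd p q.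
Proof. apply entails_ded2; intros L; apply ded_andI. Qed.

Lemma entails_andE1 G p q : G ⊢ fAnd p q -> G ⊢ p.
Proof. apply entails_ded; intros L; apply ded_andE1. Qed.

Lemma entails_andE2 G p q : G ⊢ fAnd p q -> G ⊢ q.
Proof. apply entails_ded; intros L; apply ded_andE2. Qed.

Lemma entails_orI1 G p q : G ⊢ p -> G ⊢ fOr p q.
Proof. apply entails_ded; intros L; apply ded_orI1. Qed.

Lemma entails_orI2 G p q : G ⊢ q -> G ⊢ fOr p q.
Proof. apply entails_ded; intros L; apply ded_orI2. Qed.

Lemma entails_cut G p q : G ⊢ p -> p :: G ⊢ q -> G ⊢ q.
Proof. intros; eapply entails_impE; eauto using entails_impI. Qed.

Lemma entails_orE G p q r : G ⊢ fOr p q -> p :: G ⊢ r -> q :: G ⊢ r -> G ⊢ r.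
Proof.
  intros H H1%entails_impI H2%entails_impI.
  (* The rule has three premises while [entails_ded2] merges two, so the two case branches are
     packed into one conjunction. *)
  apply entails_impE with (fAnd (fImp p r) (fImp q r));
    [|now apply entails_andI].
  revert H; apply entails_ded; intros L D; apply ded_impI; cbn.
  apply ded_orE with p q.
  - eapply ded_weaken; [exact D|intros x; cbn; auto].
  - apply ded_impE with p; [eapply ded_andE1|]; apply ded_hyp; cbn; eauto.
  - apply ded_impE with q; [eapply ded_andE2|]; apply ded_hyp; cbn; eauto.
Qed.

Lemma entails_allE G p t : G ⊢ fAll p -> G ⊢ inst p t.
Proof. apply entails_ded; intros L; apply ded_allE. Qed.

Lemma entails_allE2 G p t u :
  G ⊢ fAll (fAll p) -> G ⊢ fsubst (scons u (scons t tVar)) p.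
Proof.
  intros H; rewrite <- inst_up; apply entails_allE.
  exact (entails_allE _ _ t H).
Qed.

Lemma entails_exI G p t : G ⊢ inst p t -> G ⊢ fEx p.
Proof. apply entails_ded; intros L; apply ded_exI. Qed.

Lemma entails_eq_refl G t : G ⊢ fEq t t.
Proof. exists []; split; [intros q []|apply ded_eqI]. Qed.

Lemma entails_eqE G p t u : G ⊢ fEq t u -> G ⊢ inst p t -> G ⊢ inst p u.
Proof. apply entails_ded2; intros L; apply ded_eqE. Qed.

Lemma entails_eq_sym G t u : G ⊢ fEq t u -> G ⊢ fEq u t.
Proof.
  intros H.
  generalize (entails_eqE G (fEq (tVar 0) (tshift t)) t u H).
  unfold inst; cbn; rewrite !tinst_tshift; auto using entails_eq_refl.
Qed.

Lemma entails_eq_trans G t u v : G ⊢ fEq t u -> G ⊢ fEq u v -> G ⊢ fEq t v.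
Proof.
  intros H K; generalize (entails_eqE G (fEq (tshift t) (tVar 0)) u v K).
  unfold inst; cbn; rewrite !tinst_tshift; auto.
Qed.

Lemma entails_eq_tsubst G s t u :
  G ⊢ fEq t u ->
  G ⊢ fEq (tsubst (scons t tVar) s) (tsubst (scons u tVar) s).
Proof.
  intros H.
  generalize (entails_eqE G
    (fEq (tshift (tsubst (scons t tVar) s)) s) t u H).
  unfold inst; cbn; rewrite !tinst_tshift; auto using entails_eq_refl.
Qed.

Lemma entails_eq_succ G t u : G ⊢ fEq t u -> G ⊢ fEq (tSucc t) (tSucc u).
Proof. exact (entails_eq_tsubst G (tSucc (tVar 0)) t u). Qed.

Lemma entails_eq_plus G t t' u u' : G ⊢ fEq t t' -> G ⊢ fEq u u' ->
  G ⊢ fEq (tPlus t u) (tPlus t' u').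
Proof.
  intros H K; apply entails_eq_trans with (tPlus t' u).
  - generalize (entails_eq_tsubst G (tPlus (tVar 0) (tshift u)) t t' H).
    cbn; now rewrite !tinst_tshift.
  - generalize (entails_eq_tsubst G (tPlus (tshift t') (tVar 0)) u u' K).
    cbn; now rewrite !tinst_tshift.
Qed.

Lemma entails_eq_mult G t t' u u' : G ⊢ fEq t t' -> G ⊢ fEq u u' ->
  G ⊢ fEq (tMult t u) (tMult t' u').
Proof.
  intros H K; apply entails_eq_trans with (tMult t' u).
  - generalize (entails_eq_tsubst G (tMult (tVar 0) (tshift u)) t t' H).
    cbn; now rewrite !tinst_tshift.
  - generalize (entails_eq_tsubst G (tMult (tshift t') (tVar 0)) u u' K).
    cbn; now rewrite !tinst_tshift.
Qed.

Lemma entails_eq_le G t t' u u' : G ⊢ fEq t t' -> G ⊢ fEq u u' ->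
  G ⊢ fLe t u -> G ⊢ fLe t' u'.
Proof.
  intros H K L.
  generalize (entails_eqE G (fLe (tVar 0) (tshift u)) t t' H).
  generalize (entails_eqE G (fLe (tshift t') (tVar 0)) u u' K).
  unfold inst; cbn; rewrite !tinst_tshift; auto.
Qed.

Hypothesis T_sentences : forall p, T p -> sentence p.

(** The quantifier rules shift the whole context; axioms, being closed, survive this unchanged, so
    only [G] is shifted in the rules below. *)
Lemma map_fshift_theory L : (forall q, In q L -> T q) -> map fshift L = L.
Proof.
  intros H; rewrite <- (map_id L) at 2; apply map_ext_in; intros q Hq.
  apply fsubst_sentence; auto.
Qed.

Lemma entails_allI G p : map fshift G ⊢ p -> G ⊢ fAll p.
Proof.
  intros (L & HL & D); exists L; split; [assumption|].
  apply ded_allI; rewrite map_app, (map_fshift_theory L HL); assumption.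
Qed.

Lemma entails_exE G p q :
  G ⊢ fEx p -> p :: map fshift G ⊢ fshift q -> G ⊢ q.
Proof.
  intros (L1 & H1 & D1) (L2 & H2 & D2); exists (L1 ++ L2).
  assert (H : forall q, In q (L1 ++ L2) -> T q)
    by (intros x [|]%in_app_or; auto).
  split; [assumption|]; apply ded_exE with p.
  - apply (ded_weaken _ _ D1); intros x; rewrite !in_app_iff; tauto.
  - apply (ded_weaken _ _ D2).
    rewrite map_app, (map_fshift_theory _ H); intros x; cbn.
    rewrite !in_app_iff; tauto.
Qed.

Lemma entails_ex_mono p q : [p] ⊢ q -> [fEx p] ⊢ fEx q.
Proof.
  intros H; apply entails_exE with p; [apply entails_hyp; cbn; auto|].
  apply (entails_exI _ _ (tVar 0)); rewrite inst_up_shift_var0.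
  revert H; apply entails_weaken; intros x; cbn; tauto.
Qed.

Lemma entails_ex_elim p q : fshift q = q -> [p] ⊢ q -> [fEx p] ⊢ q.
Proof.
  intros E H; apply entails_exE with p; [apply entails_hyp; cbn; auto|].
  rewrite E; revert H; apply entails_weaken; intros x; cbn; tauto.
Qed.

Lemma entails_ex3I G p a b c :
  G ⊢ fsubst (scons c (scons b (scons a tVar))) p -> G ⊢ fEx (fEx (fEx p)).
Proof.
  intros H; apply (entails_exI _ _ a); cbn.
  apply (entails_exI _ _ b); unfold inst; cbn; rewrite fsubst_comp.
  apply (entails_exI _ _ c); unfold inst; rewrite !fsubst_comp.
  erewrite fsubst_ext; [exact H|].
  intros [|[|[|i]]]; cbn; try reflexivity.
  - now rewrite tinst_tshift.
  - unfold tshift; rewrite !tsubst_comp; now apply tsubst_id.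
Qed.

(** The shift by [k] says that [p] contains none of the quantified variables. In the fixed point
    this separates the quantifier prefix of [Pr] from the conjuncts that do not belong to [Pr]. *)
Lemma entails_iter_ex_andE k : forall G p q,
  G ⊢ Nat.iter k fEx (fAnd (fsubst (fun i => tVar (i + k)) p) q) ->
  G ⊢ fAnd p (Nat.iter k fEx q).
Proof.
  induction k as [|k IH]; intros G p q H.
  - cbn in *; rewrite fsubst_id in H; [assumption|]; intros i; f_equal; lia.
  - rewrite Nat.iter_succ in *; eapply entails_exE; [exact H|]; clear H.
    match goal with |- ?G ⊢ _ =>
      assert (K : G ⊢ fAnd (fshift p) (Nat.iter k fEx q)) end.
    { apply IH, entails_hyp; left; unfold fshift; rewrite fsubst_comp.
      do 2 f_equal; apply fsubst_ext; intros i; cbn; f_equal; lia. }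
    apply entails_andI; [apply entails_andE1 in K; exact K|].
    apply entails_andE2 in K.
    apply (entails_exI _ _ (tVar 0)); now rewrite inst_up_shift_var0.
Qed.

Lemma entails_iter_ex_andI k : forall G p q,
  In p G -> G ⊢ Nat.iter k fEx q ->
  G ⊢ Nat.iter k fEx (fAnd (fsubst (fun i => tVar (i + k)) p) q).
Proof.
  induction k as [|k IH]; intros G p q Hp H.
  - cbn in *; rewrite fsubst_id; [auto using entails_andI, entails_hyp|].
    intros i; f_equal; lia.
  - rewrite Nat.iter_succ in *; eapply entails_exE; [exact H|]; clear H.
    apply (entails_exI _ _ (tVar 0)); rewrite inst_up_shift_var0.
    replace (fsubst (fun i => tVar (i + S k)) p)
      with (fsubst (fun i => tVar (i + k)) (fshift p)).
    + apply IH; [right; now apply in_map|apply entails_hyp; now left].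
    + unfold fshift; rewrite fsubst_comp; apply fsubst_ext; intros i; cbn.
      f_equal; lia.
Qed.

End Entails.

(** * Goedel's beta function *)

Lemma chinese_remainder m M x y : 0 < M -> Nat.gcd M m = 1 -> y < m ->
  exists a, a mod M = x mod M /\ a mod m = y.
Proof.
  intros HM Hg Hy.
  destruct (Nat.gcd_bezout_pos M m HM) as (u & v & E); rewrite Hg in E.
  (* Bezout gives [u * M = 1 + v * m], so modulo [m] the witness is [x + y + (m - 1) * x], that is
     [y]. The factor [m - 1] plays the role of -1 in the natural numbers. *)
  exists (x + u * (y + (m - 1) * x) * M); split.
  - apply Nat.Div0.mod_add.
  - replace (x + u * (y + (m - 1) * x) * M)
      with (y + (x + v * (y + (m - 1) * x)) * m).
    + rewrite Nat.Div0.mod_add; now apply Nat.mod_small.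
    + destruct m as [|m]; [lia|]; cbn [Nat.sub] in *; rewrite Nat.sub_0_r in *.
      replace (u * (y + m * x) * M) with ((u * M) * (y + m * x)) by ring.
      rewrite E; ring.
Qed.

(** The moduli of the beta function: a pair [a], [b] codes the sequence with entries
    [a mod modulus b i]. *)
Definition modulus b i := 1 + (i + 1) * b.

Lemma gcd_eq_1 a b : (forall d, Nat.divide d a -> Nat.divide d b -> d = 1) ->
  Nat.gcd a b = 1.
Proof. intros H; apply H; [apply Nat.gcd_divide_l|apply Nat.gcd_divide_r]. Qed.

(** A common divisor is coprime to [b], as it divides [1 + (i + 1) * b]. It divides the difference
    [b * (j - i)], hence [j - i], hence [b], so it is 1. *)
Lemma modulus_coprime b i j : i < j -> Nat.divide (j - i) b ->
  Nat.gcd (modulus b i) (modulus b j) = 1.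
Proof.
  intros L D; apply gcd_eq_1; intros d Di Dj.
  assert (C : Nat.gcd d b = 1).
  { apply gcd_eq_1; intros e E1 E2; apply Nat.divide_1_r.
    apply (Nat.divide_add_cancel_r _ ((i + 1) * b)).
    - now apply Nat.divide_mul_r.
    - rewrite Nat.add_comm; exact (Nat.divide_trans _ _ _ E1 Di). }
  assert (E : Nat.divide d (b * (j - i))).
  { apply (Nat.divide_add_cancel_r _ (modulus b i)); [assumption|].
    replace (modulus b i + b * (j - i)) with (modulus b j); [assumption|].
    unfold modulus; replace j with (i + (j - i)) at 1 by lia; ring. }
  apply (Nat.gauss _ _ _ E), (Nat.divide_trans _ _ b) in C; [|assumption].
  apply Nat.divide_1_r, (Nat.divide_add_cancel_r _ ((i + 1) * b)).
  - now apply Nat.divide_mul_r.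
  - now rewrite Nat.add_comm.
Qed.

Lemma gcd_mul_eq_1 a b c : Nat.gcd a c = 1 -> Nat.gcd b c = 1 ->
  Nat.gcd (a * b) c = 1.
Proof.
  intros Ha Hb; apply gcd_eq_1; intros d D Dc.
  assert (E : Nat.gcd d a = 1).
  { apply gcd_eq_1; intros e E1 E2; apply Nat.divide_1_r; rewrite <- Ha.
    apply Nat.gcd_greatest; [assumption|exact (Nat.divide_trans _ _ _ E1 Dc)]. }
  apply (Nat.gauss _ _ _ D) in E; apply Nat.divide_1_r; rewrite <- Hb.
  now apply Nat.gcd_greatest.
Qed.

Lemma beta_exists_for b n (f : nat -> nat) :
  (forall k, 0 < k <= n -> Nat.divide k b) ->
  (forall i, i <= n -> f i <= b) ->
  exists a, forall i, i <= n -> a mod modulus b i = f i.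
Proof.
  intros D B.
  (* Remainders are adjusted one modulus at a time. [M] is a common multiple of the moduli already
     treated and is coprime to those still to come. *)
  assert (K : forall m, m <= S n -> exists a M, 0 < M /\
    (forall j, m <= j <= n -> Nat.gcd M (modulus b j) = 1) /\
    forall i, i < m -> a mod modulus b i = f i /\ Nat.divide (modulus b i) M).
  { induction m as [|m IH]; intros Hm.
    - exists 0, 1; repeat split; intros; lia.
    - destruct IH as (a & M & HM & C & H); [lia|].
      destruct (chinese_remainder (modulus b m) M a (f m))
        as (a' & Ea & Em); [assumption|apply C; lia|..].
      { unfold modulus; specialize (B m); nia. }
      exists a', (M * modulus b m); repeat split.
      + unfold modulus; nia.
      + intros j Hj; apply gcd_mul_eq_1; [apply C; lia|].
        apply modulus_coprime; [lia|apply D; lia].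
      + destruct (Nat.eq_dec i m) as [->|N]; [assumption|].
        destruct (H i) as [<- [q E]]; [lia|].
        (* Since [modulus b i] divides [M], the new [a'], congruent to [a] modulo [M], keeps the
           earlier remainders. *)
        assert (G : forall x, x mod M mod modulus b i = x mod modulus b i).
        { intros x; rewrite (Nat.Div0.div_mod x M) at 2; rewrite E at 2.
          replace (q * modulus b i * (x / M) + x mod M)
            with (x mod M + (q * (x / M)) * modulus b i) by ring.
          now rewrite Nat.Div0.mod_add. }
        now rewrite <- (G a'), Ea, G.
      + destruct (Nat.eq_dec i m) as [->|N].
        * apply Nat.divide_factor_r.
        * apply Nat.divide_mul_l, H; lia. }
  destruct (K (S n)) as (a & M & _ & _ & H); [lia|].
  exists a; intros i Hi; apply H; lia.
Qed.

Lemma divide_fact k : forall n, 0 < k <= n -> Nat.divide k (fact n).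
Proof.
  induction n as [|n IH]; intros H; [lia|]; cbn [fact].
  destruct (Nat.eq_dec k (S n)) as [->|N].
  - apply Nat.divide_factor_l.
  - apply Nat.divide_mul_r, IH; lia.
Qed.

Lemma beta_exists n (f : nat -> nat) :
  exists a b, forall i, i <= n -> a mod modulus b i = f i.
Proof.
  assert (B : exists m, forall i, i <= n -> f i <= m).
  { induction n as [|n [m IH]].
    - exists (f 0); intros i Hi; now replace i with 0 by lia.
    - exists (m + f (S n)); intros i Hi.
      destruct (Nat.eq_dec i (S n)) as [->|N]; [lia|].
      specialize (IH i); lia. }
  destruct B as [m B].
  (* The factorial is divisible by every positive [k <= n], which makes the moduli coprime, and by
     every nonzero value [f i <= m], hence is at least as large. *)
  destruct (beta_exists_for (fact (n + m)) n f) as [a H]; eauto.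
  - intros k Hk; apply divide_fact; lia.
  - intros i Hi; specialize (B i Hi).
    destruct (f i) as [|x] eqn:E; [lia|].
    apply Nat.divide_pos_le; [pose proof (lt_O_fact (n + m)); lia|].
    apply divide_fact; lia.
Qed.

(** * Truth in the standard model *)

Definition ncons (x : nat) (e : nat -> nat) (i : nat) : nat :=
  match i with 0 => x | S j => e j end.

Fixpoint teval (e : nat -> nat) (t : term) : nat :=
  match t with
  | tVar i => e i
  | tZero => 0
  | tSucc t => S (teval e t)
  | tPlus t u => teval e t + teval e u
  | tMult t u => teval e t * teval e u
  end.

Fixpoint sat (e : nat -> nat) (p : form) : Prop :=
  match p with
  | fEq t u => teval e t = teval e u
  | fLe t u => teval e t <= teval e u
  | fNeg p => ~ sat e p
  | fAnd p q => sat e p /\ sat e q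
  | fOr p q => sat e p \/ sat e q
  | fImp p q => sat e p -> sat e q
  | fAll p => forall x, sat (ncons x e) p
  | fEx p => exists x, sat (ncons x e) p
  end.

Lemma teval_tsubst e s t :
  teval e (tsubst s t) = teval (fun i => teval e (s i)) t.
Proof. induction t; cbn; congruence. Qed.

Lemma teval_ext e e' t : (forall i, e i = e' i) -> teval e t = teval e' t.
Proof. intros H; induction t; cbn; congruence. Qed.

Lemma teval_tshift x e t : teval (ncons x e) (tshift t) = teval e t.
Proof. unfold tshift; rewrite teval_tsubst; now apply teval_ext. Qed.

Lemma sat_ext p : forall e e',
  (forall i, e i = e' i) -> sat e p <-> sat e' p.
Proof.
  assert (U : forall x e e', (forall i, e i = e' i) ->
                             forall i, ncons x e i = ncons x e' i)
    by (intros x e e' H [|i]; cbn; auto).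
  induction p; intros e e' H; cbn;
    rewrite ?(teval_ext e e' _ H), ?(IHp e e' H), ?(IHp1 e e' H),
      ?(IHp2 e e' H); try reflexivity.
  - split; intros K x; eapply IHp; [| eapply K | | eapply K];
      intros i; [symmetry|]; apply U, H.
  - split; intros [x K]; exists x; (eapply IHp; [|exact K]);
      intros i; [symmetry|]; apply U, H.
Qed.

Lemma sat_fsubst p : forall e s,
  sat e (fsubst s p) <-> sat (fun i => teval e (s i)) p.
Proof.
  assert (U : forall x e s i, teval (ncons x e) (up s i) =
                              ncons x (fun j => teval e (s j)) i)
    by (intros x e s [|i]; cbn; [|rewrite teval_tshift]; reflexivity).
  induction p; intros e s; cbn; rewrite ?teval_tsubst, ?IHp, ?IHp1, ?IHp2;
    try reflexivity.
  - split; intros K x; specialize (K x);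
      [rewrite IHp in K|rewrite IHp]; (eapply sat_ext; [|exact K]);
      intros i; [symmetry|]; apply U.
  - split; intros [x K]; exists x;
      [rewrite IHp in K|rewrite IHp]; (eapply sat_ext; [|exact K]);
      intros i; [symmetry|]; apply U.
Qed.

Lemma teval_numeral e n : teval e (numeral n) = n.
Proof. induction n; cbn; congruence. Qed.

(** * Relations definable in the standard model *)

Definition term_def (f : (nat -> nat) -> nat) : Prop :=
  exists t, forall e, teval e t = f e.

Definition delta0_def (R : (nat -> nat) -> Prop) : Prop :=
  exists p, Delta0 p /\ forall e, sat e p <-> R e.

(** A normal form with one unbounded quantifier. The closure lemmas below turn any further unbounded
    witnesses into ones bounded by [w]. *)
Definition sigma1_def (R : (nat -> nat) -> Prop) : Prop :=
  exists p, Delta0 p /\ forall e, R e <-> exists w, sat (ncons w e) p.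

(** The graph carries the value in variable 0, and the arguments start at variable 1. *)
Definition fun_def (f : (nat -> nat) -> nat) : Prop :=
  sigma1_def (fun e => e 0 = f (fun i => e (S i))).

Lemma term_def_var i : term_def (fun e => e i).
Proof. now exists (tVar i). Qed.

Lemma term_def_const n : term_def (fun _ => n).
Proof. exists (numeral n); intros e; apply teval_numeral. Qed.

Lemma term_def_succ f : term_def f -> term_def (fun e => S (f e)).
Proof. intros [t H]; exists (tSucc t); cbn; congruence. Qed.

Lemma term_def_plus f g :
  term_def f -> term_def g -> term_def (fun e => f e + g e).
Proof. intros [t H] [u K]; exists (tPlus t u); cbn; congruence. Qed.

Lemma term_def_mult f g :
  term_def f -> term_def g -> term_def (fun e => f e * g e).
Proof. intros [t H] [u K]; exists (tMult t u); cbn; congruence. Qed.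

Lemma sigma1_def_delta0 R : delta0_def R -> sigma1_def R.
Proof.
  intros (p & D & H); exists (fshift p); split; [now apply Delta0_fsubst|].
  intros e; rewrite <- H; split; [intros K; exists 0|intros [w K]];
    unfold fshift in *; rewrite sat_fsubst in *; exact K.
Qed.

Lemma sigma1_def_eq f g :
  term_def f -> term_def g -> sigma1_def (fun e => f e = g e).
Proof.
  intros [t H] [u K]; apply sigma1_def_delta0.
  exists (fEq t u); split; [constructor|]; intros e; cbn.
  rewrite H, K; reflexivity.
Qed.

Lemma sigma1_def_le f g :
  term_def f -> term_def g -> sigma1_def (fun e => f e <= g e).
Proof.
  intros [t H] [u K]; apply sigma1_def_delta0.
  exists (fLe t u); split; [constructor|]; intros e; cbn.
  rewrite H, K; reflexivity.
Qed.

Lemma sigma1_def_iff P Q :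
  (forall e, P e <-> Q e) -> sigma1_def P -> sigma1_def Q.
Proof.
  intros H (p & D & K); exists p; split; [assumption|].
  intros e; rewrite <- H; apply K.
Qed.

Lemma sigma1_def_rename R (r : nat -> nat) :
  sigma1_def R -> sigma1_def (fun e => R (fun i => e (r i))).
Proof.
  intros (p & D & H).
  exists (fsubst (up (fun i => tVar (r i))) p); split;
    [now apply Delta0_fsubst|].
  intros e; rewrite H.
  assert (K : forall w, sat (ncons w e) (fsubst (up (fun i => tVar (r i))) p)
                        <-> sat (ncons w (fun i => e (r i))) p).
  { intros w; rewrite sat_fsubst; apply sat_ext; now intros [|i]. }
  split; intros [w Hw]; exists w; now apply K.
Qed.

Definition bounded_ex (p : form) : form :=
  fEx (fAnd (fLe (tVar 0) (tVar 1)) p).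

Lemma Delta0_bounded_ex p : Delta0 p -> Delta0 (bounded_ex p).
Proof. exact (D0_ex (tVar 0) p). Qed.

(** Makes room at index 1 for the common bound, which [p] must not see. *)
Definition skip1 (p : form) : form :=
  fsubst (scons (tVar 0) (fun i => tVar (S (S i)))) p.

Lemma sat_skip1 w x e p : sat (ncons w (ncons x e)) (skip1 p) <->
  sat (ncons w e) p.
Proof. unfold skip1; rewrite sat_fsubst; apply sat_ext; now intros [|i]. Qed.

Lemma sigma1_def_and P Q :
  sigma1_def P -> sigma1_def Q -> sigma1_def (fun e => P e /\ Q e).
Proof.
  intros (p & Dp & Hp) (q & Dq & Hq).
  exists (fAnd (bounded_ex (skip1 p)) (bounded_ex (skip1 q))); split.
  - constructor; now apply Delta0_bounded_ex, Delta0_fsubst.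
  - intros e; rewrite Hp, Hq; split.
    (* The sum bounds both witnesses, so a single unbounded quantifier suffices. *)
    + intros [[u Hu] [v Hv]]; exists (u + v); cbn; split;
        [exists u|exists v]; split; try lia; now apply sat_skip1.
    + cbn; intros (w & [u [_ Hu]] & [v [_ Hv]]).
      split; [exists u|exists v]; eapply sat_skip1; eassumption.
Qed.

Lemma sigma1_def_ex (P : nat -> (nat -> nat) -> Prop) :
  sigma1_def (fun e => P (e 0) (fun i => e (S i))) ->
  sigma1_def (fun e => exists x, P x e).
Proof.
  intros (p & D & H).
  (* [r] skips index 2, which holds the new unbounded witness; that witness bounds both [x] and the
     old witness [w]. *)
  set (r := scons (tVar 0) (scons (tVar 1) (fun i => tVar (S (S (S i)))))).
  assert (K : forall w x b e, sat (ncons w (ncons x (ncons b e))) (fsubst r p)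
                              <-> sat (ncons w (ncons x e)) p)
    by (intros; rewrite sat_fsubst; apply sat_ext; now intros [|[|i]]).
  exists (bounded_ex (fEx (fAnd (fLe (tVar 0) (tVar 2)) (fsubst r p)))).
  split.
  - apply Delta0_bounded_ex, (D0_ex (tVar 1)); now apply Delta0_fsubst.
  - intros e; split.
    + intros [x Hx]; destruct (proj1 (H (ncons x e)) Hx) as [w Hw].
      exists (x + w), x; cbn; split; [lia|]; exists w; split; [lia|].
      now apply K.
    + intros (b & x & _ & w & _ & Hw); exists x.
      apply (H (ncons x e)); exists w; eapply K, Hw.
Qed.

Lemma collection n (P : nat -> nat -> Prop) :
  (forall x, x <= n -> exists w, P x w) ->
  exists b, forall x, x <= n -> exists w, w <= b /\ P x w.
Proof.
  induction n as [|n IH]; intros H.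
  - destruct (H 0) as [w Hw]; [lia|]; exists w; intros x Hx.
    exists w; split; [lia|]; now replace x with 0 by lia.
  - destruct IH as [b Hb]; [intros; apply H; lia|].
    destruct (H (S n)) as [w Hw]; [lia|]; exists (b + w); intros x Hx.
    destruct (Nat.eq_dec x (S n)) as [->|N].
    + exists w; split; [lia|assumption].
    + destruct (Hb x) as (v & Lv & Hv); [lia|].
      exists v; split; [lia|assumption].
Qed.

(** By [collection], the witnesses for all [x <= f e] have one common bound [b], so the unbounded
    quantifier moves in front of the bounded one. *)
Lemma sigma1_def_ball f (P : nat -> (nat -> nat) -> Prop) :
  term_def f -> sigma1_def (fun e => P (e 0) (fun i => e (S i))) ->
  sigma1_def (fun e => forall x, x <= f e -> P x e).
Proof.
  intros [t Ht] (p & D & H).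
  set (r := scons (tVar 0) (scons (tVar 1) (fun i => tVar (S (S (S i)))))).
  assert (K : forall w x b e, sat (ncons w (ncons x (ncons b e))) (fsubst r p)
                              <-> sat (ncons w (ncons x e)) p)
    by (intros; rewrite sat_fsubst; apply sat_ext; now intros [|[|i]]).
  exists (fAll (fImp (fLe (tVar 0) (tshift (tshift t)))
                     (fEx (fAnd (fLe (tVar 0) (tVar 2)) (fsubst r p))))).
  split.
  - constructor; apply (D0_ex (tVar 1)); now apply Delta0_fsubst.
  - intros e; split.
    + intros Hx.
      destruct (collection (f e) (fun x w => sat (ncons w (ncons x e)) p))
        as [b Hb].
      { intros x Lx; apply (H (ncons x e)); cbn; auto. }
      exists b; cbn; intros x; rewrite !teval_tshift, Ht; intros Lx.
      destruct (Hb x Lx) as (w & Lw & Hw); exists w; split; [assumption|].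
      now apply K.
    + cbn; intros [b Hb] x Lx; specialize (Hb x).
      rewrite !teval_tshift, Ht in Hb; destruct (Hb Lx) as (w & _ & Hw).
      apply (H (ncons x e)); exists w; eapply K, Hw.
Qed.

(** * Sigma1-definability of the coding functions *)

Ltac term_def := repeat first
  [ apply term_def_var | apply term_def_const | apply term_def_succ
  | apply term_def_plus | apply term_def_mult ].

Ltac sigma1_def := repeat first
  [ apply sigma1_def_and | apply sigma1_def_eq | apply sigma1_def_le
  | apply sigma1_def_ball | apply sigma1_def_ex ]; term_def.

(** Twice the Cantor pairing of two numbers is a polynomial in them; doubling both sides avoids
    division by 2. *)
Lemma node_graph z a b c :
  z = node a b c <->
  exists q, q * 2 = c * 2 + (c + b) * S (c + b) /\
            z * 2 = q * 2 + (q + a) * S (q + a).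
Proof.
  unfold node; split.
  - intros ->; exists (to_nat (b, c)); split; apply to_nat_spec.
  - intros (q & Hq & Hz).
    pose proof (to_nat_spec b c); replace q with (to_nat (b, c)) in * by lia.
    pose proof (to_nat_spec a (to_nat (b, c))); lia.
Qed.

Lemma sigma1_def_node i j k l :
  sigma1_def (fun e => e i = node (e j) (e k) (e l)).
Proof.
  eapply sigma1_def_iff;
    [intros e; symmetry; apply node_graph|]; sigma1_def.
Qed.

Lemma fun_def_term f : term_def f -> fun_def f.
Proof.
  intros [t H]; apply sigma1_def_eq; [apply term_def_var|].
  exists (tshift t); intros e; rewrite <- H; apply teval_tsubst.
Qed.

Lemma fun_def_node f g h : fun_def f -> fun_def g -> fun_def h ->
  fun_def (fun e => node (f e) (g e) (h e)).
Proof.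
  intros Hf Hg Hh.
  apply sigma1_def_iff with (fun e => exists u v w,
    (u = f (fun i => e (S i)) /\ v = g (fun i => e (S i)) /\
     w = h (fun i => e (S i))) /\ e 0 = node u v w).
  { intros e; split; [intros (u & v & w & (-> & -> & ->) & E); exact E|].
    intros E; do 3 eexists; split; [repeat split|exact E]. }
  do 3 apply sigma1_def_ex; repeat apply sigma1_def_and.
  (* Under the three quantifiers [w], [v], [u] are variables 0, 1, 2 and the value of the whole
     function is variable 3, so the arguments start at 4. *)
  - exact (sigma1_def_rename _ (ncons 2 (fun i => 4 + i)) Hf).
  - exact (sigma1_def_rename _ (ncons 1 (fun i => 4 + i)) Hg).
  - exact (sigma1_def_rename _ (ncons 0 (fun i => 4 + i)) Hh).
  - apply sigma1_def_node.
Qed.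

Lemma beta_graph a b i c : a mod modulus b i = c <->
  exists q, a = q * S ((i + 1) * b) + c /\ c <= (i + 1) * b.
Proof.
  unfold modulus; cbn [Nat.add]; split.
  - intros <-; exists (a / S ((i + 1) * b)); split.
    + rewrite (Nat.Div0.div_mod a (S ((i + 1) * b))) at 1; lia.
    + pose proof (Nat.mod_upper_bound a (S ((i + 1) * b))); lia.
  - intros (q & -> & L); rewrite Nat.add_comm, Nat.Div0.mod_add.
    apply Nat.mod_small; lia.
Qed.

Lemma tcode_numeral_graph n c : c = tcode (numeral n) <->
  exists a b, (a mod modulus b 0 = tcode tZero /\ a mod modulus b n = c) /\
    forall i, i <= n -> exists u v,
      (a mod modulus b i = u /\ a mod modulus b (S i) = v) /\ v = node 2 u 0.
Proof.
  split.
  - intros ->.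
    (* The recursion clause at [i = n] mentions entry [S n], so the sequence is coded up to that
       index. *)
    destruct (beta_exists (S n) (fun i => tcode (numeral i)))
      as (a & b & H).
    exists a, b; repeat split; [apply (H 0); lia|apply H; lia|].
    intros i Hi; exists (tcode (numeral i)), (tcode (numeral (S i))).
    repeat split; apply H; lia.
  - intros (a & b & [H0 <-] & H).
    assert (K : forall i, i <= n -> a mod modulus b i = tcode (numeral i)).
    { induction i as [|i IH]; intros Hi; [assumption|].
      destruct (H i) as (u & v & [<- <-] & E); [lia|].
      rewrite E, IH by lia; reflexivity. }
    apply K; lia.
Qed.

Lemma fun_def_tcode_numeral i : fun_def (fun e => tcode (numeral (e i))).
Proof.
  eapply sigma1_def_iff;
    [intros e; symmetry; apply tcode_numeral_graph|].
  set (z := tcode tZero).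
  assert (B : forall f g h k, term_def f -> term_def g -> term_def h ->
    term_def k -> sigma1_def (fun e => f e mod modulus (g e) (h e) = k e)).
  { intros f g h k [tf Hf] [tg Hg] [th Hh] [tk Hk].
    eapply sigma1_def_iff; [intros e; symmetry; apply beta_graph|].
    apply sigma1_def_ex, sigma1_def_and;
      [apply sigma1_def_eq|apply sigma1_def_le]; term_def;
    [exists (tshift tf)|exists (tshift th)|exists (tshift tg)
    |exists (tshift tk)|exists (tshift tk)|exists (tshift th)
    |exists (tshift tg)];
    intros e; rewrite <- ?Hf, <- ?Hg, <- ?Hh, <- ?Hk; apply teval_tsubst. }
  do 2 apply sigma1_def_ex; repeat apply sigma1_def_and;
    [apply B; term_def|apply B; term_def|].
  apply sigma1_def_ball; [term_def|].
  do 2 apply sigma1_def_ex; repeat apply sigma1_def_and;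
    [apply B; term_def|apply B; term_def|].
  eapply sigma1_def_iff; [intros e; symmetry; apply node_graph|]; sigma1_def.
Qed.

Lemma fun_def_iter_node k tag f : fun_def f ->
  fun_def (fun e => Nat.iter k (fun c => node tag c 0) (f e)).
Proof.
  intros H; induction k as [|k IH]; cbn; [assumption|].
  apply fun_def_node; auto using fun_def_term, term_def_const.
Qed.

(** * Delta0-completeness of Peano arithmetic *)

Local Notation "G ⊢ p" := (entails PA G p) (at level 70).

Lemma PA_sentences p : PA p -> sentence p.
Proof. intros []; unfold sentence; cbn; auto; repeat split; lia. Qed.

Lemma PA_nil G p : [] ⊢ p -> G ⊢ p.
Proof. apply entails_weaken; intros x []. Qed.

Lemma PA_succ_neq_zero G t : G ⊢ fNeg (fEq (tSucc t) tZero).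
Proof. exact (entails_allE _ _ _ t (entails_axiom _ _ _ PA_succ_neq0)). Qed.

Lemma PA_succ_injective G t u :
  G ⊢ fEq (tSucc t) (tSucc u) -> G ⊢ fEq t u.
Proof.
  apply entails_impE.
  exact (entails_allE2 _ G _ t u (entails_axiom _ _ _ PA_succ_inj)).
Qed.

Lemma PA_plus_zero G t : G ⊢ fEq (tPlus t tZero) t.
Proof. exact (entails_allE _ _ _ t (entails_axiom _ _ _ PA_plus0)). Qed.

Lemma PA_plus_succ G t u :
  G ⊢ fEq (tPlus t (tSucc u)) (tSucc (tPlus t u)).
Proof.
  exact (entails_allE2 _ G _ t u (entails_axiom _ _ _ PA_plusS)).
Qed.

Lemma PA_mult_zero G t : G ⊢ fEq (tMult t tZero) tZero.
Proof. exact (entails_allE _ _ _ t (entails_axiom _ _ _ PA_mult0)). Qed.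

Lemma PA_mult_succ G t u :
  G ⊢ fEq (tMult t (tSucc u)) (tPlus (tMult t u) t).
Proof.
  exact (entails_allE2 _ G _ t u (entails_axiom _ _ _ PA_multS)).
Qed.

Lemma PA_le_iff G t u :
  G ⊢ fIff (fLe t u) (fEx (fEq (tPlus (tVar 0) (tshift t)) (tshift u))).
Proof.
  exact (entails_allE2 _ G _ t u (entails_axiom _ _ _ PA_le)).
Qed.

Lemma PA_leI G z t u : G ⊢ fEq (tPlus z t) u -> G ⊢ fLe t u.
Proof.
  intros H; eapply entails_impE; [eapply entails_andE2, PA_le_iff|].
  apply (entails_exI _ _ _ z); unfold inst; cbn; now rewrite !tinst_tshift.
Qed.

Lemma PA_leE G t u : G ⊢ fLe t u ->
  G ⊢ fEx (fEq (tPlus (tVar 0) (tshift t)) (tshift u)).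
Proof. apply entails_impE; eapply entails_andE1, PA_le_iff. Qed.

Lemma PA_zero_le G t : G ⊢ fLe tZero t.
Proof. apply PA_leI with t, PA_plus_zero. Qed.

Lemma PA_le_succ G t u : G ⊢ fLe t u -> G ⊢ fLe (tSucc t) (tSucc u).
Proof.
  intros H; eapply (entails_exE _ PA_sentences); [apply PA_leE, H|].
  apply PA_leI with (tVar 0); cbn.
  eapply entails_eq_trans; [apply PA_plus_succ|].
  apply entails_eq_succ, entails_hyp; now left.
Qed.

Lemma PA_le_pred G t u : G ⊢ fLe (tSucc t) (tSucc u) -> G ⊢ fLe t u.
Proof.
  intros H; eapply (entails_exE _ PA_sentences); [apply PA_leE, H|].
  apply PA_leI with (tVar 0), PA_succ_injective.
  eapply entails_eq_trans; [apply entails_eq_sym, PA_plus_succ|].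
  apply entails_hyp; now left.
Qed.

Lemma PA_not_succ_le_zero G t : G ⊢ fNeg (fLe (tSucc t) tZero).
Proof.
  apply entails_negI with (fEq tZero tZero); [apply entails_eq_refl|].
  eapply (entails_exE _ PA_sentences);
    [apply PA_leE, entails_hyp; now left|].
  eapply entails_absurd;
    [|apply (PA_succ_neq_zero _ (tPlus (tVar 0) (tshift t)))].
  eapply entails_eq_trans; [apply entails_eq_sym, PA_plus_succ|].
  apply entails_hyp; now left.
Qed.

(** The only instance of the induction schema invoked in the development; later inductions on
    numerals take place outside PA. *)
Lemma PA_zero_or_succ G t :
  G ⊢ fOr (fEq t tZero) (fEx (fEq (tshift t) (tSucc (tVar 0)))).
Proof.
  set (p := fOr (fEq (tVar 0) tZero) (fEx (fEq (tVar 1) (tSucc (tVar 0))))).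
  refine (entails_allE _ _ p t _); apply PA_nil.
  apply entails_impE with
    (fAnd (inst p tZero)
       (fAll (fImp p
          (fsubst (scons (tSucc (tVar 0)) (fun i => tVar (S i))) p)))).
  - apply entails_axiom, (PA_induction 0); cbn; repeat split; lia.
  - apply entails_andI; [apply entails_orI1, entails_eq_refl|].
    apply (entails_allI _ PA_sentences), entails_impI, entails_orI2.
    apply (entails_exI _ _ _ (tVar 0)), entails_eq_refl.
Qed.

(** Induction on the standard number [m], with [t] arbitrary: [t] is zero or a successor, and in the
    latter case both sides lose one successor. *)
Lemma PA_le_total_numeral m t :
  forall G, G ⊢ fOr (fLe t (numeral m)) (fLe (numeral m) t).
Proof.
  revert t; induction m as [|m IH]; intros t G.
  - apply entails_orI2, PA_zero_le.
  - eapply entails_orE; [apply (PA_zero_or_succ _ t)| |].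
    + apply entails_orI1; eapply entails_eq_le;
        [apply entails_eq_sym, entails_hyp; now left
        |apply entails_eq_refl|apply PA_zero_le].
    + eapply (entails_exE _ PA_sentences); [apply entails_hyp; now left|].
      cbn [fshift fsubst numeral tsubst]; rewrite tsubst_numeral.
      match goal with |- ?G ⊢ _ =>
        assert (E : G ⊢ fEq (tSucc (tVar 0)) (tshift t))
          by (apply entails_eq_sym, entails_hyp; now left) end.
      eapply entails_orE; [apply (IH (tVar 0))| |].
      * apply entails_orI1; eapply entails_eq_le;
          [eapply entails_weaken, E; now right|apply entails_eq_refl|].
        apply PA_le_succ, entails_hyp; now left.
      * apply entails_orI2; eapply entails_eq_le;
          [apply entails_eq_refl|eapply entails_weaken, E; now right|].
        apply PA_le_succ, entails_hyp; now left.
Qed.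

Fixpoint eq_some_upto (t : term) (n : nat) : form :=
  match n with
  | 0 => fEq t tZero
  | S m => fOr (eq_some_upto t m) (fEq t (numeral n))
  end.

Lemma eq_some_uptoI G t m n : m <= n -> G ⊢ fEq t (numeral m) ->
  G ⊢ eq_some_upto t n.
Proof.
  intros L H; induction n as [|n IH].
  - replace m with 0 in H by lia; exact H.
  - destruct (Nat.eq_dec m (S n)) as [->|N];
      [now apply entails_orI2|apply entails_orI1, IH; lia].
Qed.

(** Stated with an arbitrary goal [q] and an extended context, so that it serves as a finite case
    analysis. *)
Lemma eq_some_uptoE t n q : forall G, G ⊢ eq_some_upto t n ->
  (forall m H, m <= n -> incl G H -> H ⊢ fEq t (numeral m) -> H ⊢ q) -> G ⊢ q.
Proof.
  induction n as [|n IH]; cbn; intros G H K.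
  - apply (K 0); [lia|apply incl_refl|assumption].
  - eapply entails_orE; [exact H| |].
    + apply IH; [apply entails_hyp; now left|].
      intros m G' Hm I; apply K; [lia|].
      intros x Hx; apply I; now right.
    + apply (K (S n)); [lia|now intros x; right|apply entails_hyp; now left].
Qed.

Lemma fsubst_eq_some_upto s t n :
  fsubst s (eq_some_upto t n) = eq_some_upto (tsubst s t) n.
Proof.
  induction n as [|n IH]; cbn; [|rewrite IH, tsubst_numeral]; reflexivity.
Qed.

(** Induction on [n] outside PA: a nonzero [t] is a successor, and its predecessor lies below the
    preceding numeral. *)
Lemma PA_le_numeral n : forall G t,
  In (fLe t (numeral n)) G -> G ⊢ eq_some_upto t n.
Proof.
  induction n as [|n IH]; intros G t H;
    (eapply entails_orE; [apply (PA_zero_or_succ _ t)| |]).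
  - apply entails_hyp; now left.
  - eapply (entails_exE _ PA_sentences); [apply entails_hyp; now left|].
    eapply entails_absurd; [|apply (PA_not_succ_le_zero _ (tVar 0))].
    eapply entails_eq_le; [|apply entails_eq_refl|];
      apply entails_hyp; [now left|].
    right; right; now apply (in_map fshift) in H.
  - apply (eq_some_uptoI _ _ 0); [lia|apply entails_hyp; now left].
  - eapply (entails_exE _ PA_sentences); [apply entails_hyp; now left|].
    replace (fshift (eq_some_upto t (S n))) with (eq_some_upto (tshift t) (S n))
      by (symmetry; apply fsubst_eq_some_upto).
    eapply entails_cut.
    { apply (PA_le_pred _ (tVar 0) (numeral n)).
      eapply entails_eq_le; [|apply entails_eq_refl|];
        apply entails_hyp; [now left|].
      right; right; apply (in_map fshift) in H; cbn in H.
      rewrite tsubst_numeral in H; exact H. }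
    eapply eq_some_uptoE; [apply IH; now left|].
    intros m K Hm I E; apply (eq_some_uptoI _ _ (S m)); [lia|].
    eapply entails_eq_trans; [|apply entails_eq_succ, E].
    apply entails_hyp, I; cbn; auto.
Qed.

Lemma PA_le_numeralE G t n q : G ⊢ fLe t (numeral n) ->
  (forall m H, m <= n -> incl G H -> H ⊢ fEq t (numeral m) -> H ⊢ q) -> G ⊢ q.
Proof.
  intros H; apply eq_some_uptoE; eapply entails_cut; [exact H|].
  apply PA_le_numeral; now left.
Qed.

Definition close (e : nat -> nat) (i : nat) : term := numeral (e i).

Lemma PA_plus_numeral G m n :
  G ⊢ fEq (tPlus (numeral m) (numeral n)) (numeral (m + n)).
Proof.
  induction n as [|n IH]; cbn.
  - rewrite Nat.add_0_r; apply PA_plus_zero.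
  - rewrite Nat.add_succ_r; eapply entails_eq_trans; [apply PA_plus_succ|].
    now apply entails_eq_succ.
Qed.

Lemma PA_mult_numeral G m n :
  G ⊢ fEq (tMult (numeral m) (numeral n)) (numeral (m * n)).
Proof.
  induction n as [|n IH]; cbn.
  - rewrite Nat.mul_0_r; apply PA_mult_zero.
  - rewrite Nat.mul_succ_r; eapply entails_eq_trans; [apply PA_mult_succ|].
    eapply entails_eq_trans; [|apply PA_plus_numeral].
    apply entails_eq_plus; [exact IH|apply entails_eq_refl].
Qed.

Lemma PA_teval G e t : G ⊢ fEq (tsubst (close e) t) (numeral (teval e t)).
Proof.
  induction t; cbn.
  - apply entails_eq_refl.
  - apply entails_eq_refl.
  - now apply entails_eq_succ.
  - eapply entails_eq_trans; [apply entails_eq_plus; eassumption|].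
    apply PA_plus_numeral.
  - eapply entails_eq_trans; [apply entails_eq_mult; eassumption|].
    apply PA_mult_numeral.
Qed.

Lemma PA_numeral_neq m : forall n G,
  m <> n -> G ⊢ fEq (numeral m) (numeral n) -> forall q, G ⊢ q.
Proof.
  induction m as [|m IH]; intros [|n] G N H q; cbn in H.
  - lia.
  - eapply entails_absurd; [apply entails_eq_sym, H|apply PA_succ_neq_zero].
  - eapply entails_absurd; [apply H|apply PA_succ_neq_zero].
  - apply (IH n); [lia|now apply PA_succ_injective].
Qed.

Lemma PA_numeral_not_le m : forall n G,
  n < m -> G ⊢ fLe (numeral m) (numeral n) -> forall q, G ⊢ q.
Proof.
  induction m as [|m IH]; intros [|n] G L H q; cbn in H; try lia.
  - eapply entails_absurd; [exact H|apply PA_not_succ_le_zero].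
  - apply (IH n); [lia|now apply PA_le_pred].
Qed.

Lemma PA_numeral_le G m n : m <= n -> G ⊢ fLe (numeral m) (numeral n).
Proof.
  intros L; apply PA_leI with (numeral (n - m)).
  replace n with (n - m + m) at 2 by lia; apply PA_plus_numeral.
Qed.

Lemma fsubst_up_close e x p :
  inst (fsubst (up (close e)) p) (numeral x) = fsubst (close (ncons x e)) p.
Proof. rewrite inst_up; apply fsubst_ext; now intros [|i]. Qed.

(** Presents the body as its own instance at variable 0, the form in which [entails_eqE] can trade
    that variable for an equal numeral. *)
Lemma inst_up_close_var0 e p :
  inst (fsubst (up (close e)) p) (tVar 0) = fsubst (up (close e)) p.
Proof.
  rewrite inst_up; apply fsubst_ext; intros [|i]; cbn; [reflexivity|].
  unfold close; now rewrite tshift_numeral.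
Qed.

Lemma PA_bounded_cases G e t q :
  G ⊢ fLe (tVar 0) (tshift (tsubst (close e) t)) ->
  (forall x H, x <= teval e t -> incl G H ->
     H ⊢ fEq (numeral x) (tVar 0) -> H ⊢ q) -> G ⊢ q.
Proof.
  intros H K; apply PA_le_numeralE with (tVar 0) (teval e t).
  - eapply entails_eq_le; [apply entails_eq_refl| |exact H].
    replace (tshift (tsubst (close e) t)) with (tsubst (close e) t);
      [apply PA_teval|].
    unfold tshift; rewrite tsubst_comp; apply tsubst_ext; intros i.
    symmetry; apply tsubst_numeral.
  - intros x H' L I E; apply (K x); auto using entails_eq_sym.
Qed.

(** Truth and falsity are treated together because negation and implication exchange them. A bounded
    quantifier reduces to finitely many numerals by [PA_bounded_cases]. *)
Lemma PA_delta0_complete p : Delta0 p -> forall e,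
  (sat e p -> [] ⊢ fsubst (close e) p) /\
  (~ sat e p -> [] ⊢ fNeg (fsubst (close e) p)).
Proof.
  induction 1 as [t u|t u|p _ IH|p q _ IHp _ IHq|p q _ IHp _ IHq
                 |p q _ IHp _ IHq|t p _ IH|t p _ IH]; intros e; cbn.
  - split.
    + intros E; eapply entails_eq_trans; [apply PA_teval|].
      rewrite E; apply entails_eq_sym, PA_teval.
    + intros N; eapply entails_negI with (fEq tZero tZero);
        [apply entails_eq_refl|].
      apply (PA_numeral_neq _ _ _ N).
      eapply entails_eq_trans; [apply entails_eq_sym, PA_teval|].
      eapply entails_eq_trans; [apply entails_hyp; now left|].
      apply PA_teval.
  - split.
    + intros L; eapply entails_eq_le;
        [apply entails_eq_sym, PA_teval|apply entails_eq_sym, PA_teval|].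
      now apply PA_numeral_le.
    + intros N; eapply entails_negI with (fEq tZero tZero);
        [apply entails_eq_refl|].
      apply (PA_numeral_not_le (teval e t) (teval e u)); [lia|].
      eapply entails_eq_le; [apply PA_teval|apply PA_teval|].
      apply entails_hyp; now left.
  - destruct (IH e) as [P N]; split; [assumption|].
    intros K; eapply entails_negI;
      [apply PA_nil, P|apply entails_hyp; now left].
    now apply NNPP.
  - destruct (IHp e) as [Pp Np], (IHq e) as [Pq Nq]; split.
    + intros [Hp Hq]; apply entails_andI; auto.
    + intros N; destruct (classic (sat e p)) as [Hp|Hp].
      * apply entails_negI with (fsubst (close e) q);
          [eapply entails_andE2, entails_hyp; now left|].
        apply PA_nil; tauto.
      * apply entails_negI with (fsubst (close e) p);
          [eapply entails_andE1, entails_hyp; now left|].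
        apply PA_nil; tauto.
  - destruct (IHp e) as [Pp Np], (IHq e) as [Pq Nq]; split.
    + intros [Hp|Hq]; [apply entails_orI1|apply entails_orI2]; auto.
    + intros N; apply entails_negI with (fEq tZero tZero);
        [apply entails_eq_refl|].
      eapply entails_orE; [apply entails_hyp; now left| |];
        (eapply entails_absurd; [apply entails_hyp; now left|]);
        apply PA_nil; tauto.
  - destruct (IHp e) as [Pp Np], (IHq e) as [Pq Nq]; split.
    + intros H; apply entails_impI; destruct (classic (sat e p)) as [Hp|Hp].
      * apply PA_nil; auto.
      * eapply entails_absurd; [apply entails_hyp; now left|].
        apply PA_nil; auto.
    + intros N; apply entails_negI with (fsubst (close e) q).
      * eapply entails_impE; [apply entails_hyp; now left|].
        apply PA_nil, Pp; tauto.
      * apply PA_nil, Nq; tauto.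
  - rewrite tsubst_up_tshift; split.
    + intros H; apply (entails_allI _ PA_sentences), entails_impI.
      apply (PA_bounded_cases _ e t); [apply entails_hyp; now left|].
      intros x G L _ E; rewrite <- inst_up_close_var0.
      apply (entails_eqE _ _ _ _ _ E); rewrite fsubst_up_close.
      apply PA_nil, IH, H; cbn; now rewrite teval_tshift.
    + intros N; apply not_all_ex_not in N as [x N].
      apply imply_to_and in N as [L N]; rewrite teval_tshift in L; cbn in L.
      apply entails_negI with (fsubst (close (ncons x e)) p);
        [|apply PA_nil, IH, N].
      rewrite <- fsubst_up_close; eapply entails_impE.
      * refine (entails_allE _ _ (fImp _ _) (numeral x) _).
        apply entails_hyp; now left.
      * cbn; rewrite tinst_tshift; eapply entails_eq_le;
          [apply entails_eq_refl|apply entails_eq_sym, PA_teval|].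
        now apply PA_numeral_le.
  - rewrite tsubst_up_tshift; split.
    + intros (x & L & H); rewrite teval_tshift in L; cbn in L.
      apply (entails_exI _ _ _ (numeral x)); unfold inst; cbn.
      fold (inst (fsubst (up (close e)) p) (numeral x)).
      rewrite tinst_tshift, fsubst_up_close.
      apply entails_andI; [|now apply IH].
      eapply entails_eq_le;
        [apply entails_eq_refl|apply entails_eq_sym, PA_teval|].
      now apply PA_numeral_le.
    + intros N; apply entails_negI with (fEq tZero tZero);
        [apply entails_eq_refl|].
      eapply (entails_exE _ PA_sentences); [apply entails_hyp; now left|].
      apply (PA_bounded_cases _ e t);
        [eapply entails_andE1, entails_hyp; now left|].
      intros x G L I E.
      apply entails_absurd with (fsubst (close (ncons x e)) p).
      * rewrite <- fsubst_up_close.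
        apply (entails_eqE _ _ _ _ _ (entails_eq_sym _ _ _ _ E)).
        rewrite inst_up_close_var0.
        eapply entails_andE2, entails_hyp, I; now left.
      * apply PA_nil, IH; intros H; apply N; exists x; cbn.
        now rewrite teval_tshift.
Qed.

(** * A Sigma1 fixed point *)

Definition env3 (x y z : nat) : nat -> nat :=
  ncons x (ncons y (ncons z (fun _ => 0))).

(** Here [z] bounds the value as well as the inner witness, so that bounded quantifiers can later
    range over all values with a small witness. *)
Lemma graph_delta0 (F : nat -> nat) : fun_def (fun e => F (e 0)) ->
  exists Q, Delta0 Q /\
    forall x y, y = F x <-> exists z, y <= z /\ sat (env3 y z x) Q.
Proof.
  intros (p & D & H).
  set (r := scons (tVar 0) (scons (tVar 1) (fun i => tVar (S (S (S i)))))).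
  exists (fEx (fAnd (fLe (tVar 0) (tVar 2)) (fsubst r p))); split.
  - apply (D0_ex (tVar 1)); now apply Delta0_fsubst.
  - assert (K : forall w x y z, sat (ncons w (env3 y z x)) (fsubst r p) <->
      sat (ncons w (ncons y (ncons x (fun _ => 0)))) p)
      by (intros; rewrite sat_fsubst; apply sat_ext; now intros [|[|[|]]]).
    intros x y; etransitivity; [apply (H (ncons y (ncons x (fun _ => 0))))|].
    split.
    + intros [w Hw]; exists (y + w); split; [lia|].
      exists w; split; [cbn; lia|now apply K].
    + intros (z & _ & w & _ & Hw); exists w; eapply K, Hw.
Qed.

Definition graph_form (Q : form) (y z x : term) : form :=
  fsubst (scons y (scons z (scons x (fun _ => tZero)))) Q.

(* [z] witnesses that [y] is the value at [x], and no smaller witness gives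
   another value.  The second clause makes the value provably unique. *)
Definition value_form (Q : form) (y z x : term) : form :=
  fAnd (fAnd (fLe y z) (graph_form Q y z x))
    (fAll (fImp (fLe (tVar 0) (tshift z))
       (fAll (fImp (fLe (tVar 0) (tVar 1))
          (fImp (graph_form Q (tVar 0) (tVar 1) (tshift (tshift x)))
                (fEq (tVar 0) (tshift (tshift y)))))))).

Lemma fsubst_graph_form s Q y z x :
  fsubst s (graph_form Q y z x) =
  graph_form Q (tsubst s y) (tsubst s z) (tsubst s x).
Proof.
  unfold graph_form; rewrite fsubst_comp; apply fsubst_ext.
  now intros [|[|[|i]]].
Qed.

Lemma fsubst_value_form s Q y z x :
  fsubst s (value_form Q y z x) =
  value_form Q (tsubst s y) (tsubst s z) (tsubst s x).
Proof.
  unfold value_form; cbn; rewrite !fsubst_graph_form, !tsubst_up_tshift.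
  reflexivity.
Qed.

Lemma Delta0_value_form Q y z x : Delta0 Q -> Delta0 (value_form Q y z x).
Proof.
  intros D; unfold value_form, graph_form; repeat constructor;
    auto using Delta0_fsubst.
  apply (D0_all (tVar 0)); repeat constructor; auto using Delta0_fsubst.
Qed.

Lemma form_below_value_form k Q y z x :
  term_below k y -> term_below k z -> term_below k x ->
  form_below k (value_form Q y z x).
Proof.
  intros Hy Hz Hx; unfold value_form, graph_form; cbn.
  repeat split; auto using term_below_tshift; try lia;
    apply form_below_fsubst; intros [|[|[|i]]]; cbn;
    auto using term_below_tshift; lia.
Qed.

Lemma graph_form_numeral Q y z x :
  graph_form Q (numeral y) (numeral z) (numeral x) =
  fsubst (close (env3 y z x)) Q.
Proof. apply fsubst_ext; now intros [|[|[|i]]]. Qed.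

Section ValueForm.
Variables (F : nat -> nat) (Q : form).
Hypothesis Q_Delta0 : Delta0 Q.
Hypothesis Q_graph :
  forall x y, y = F x <-> exists z, y <= z /\ sat (env3 y z x) Q.

(** Let [m] be a standard witness for [F n]. If [z <= m], then [y] and [z] equal numerals and
    Delta0-completeness decides [Q] there. If [m <= z], the uniqueness clause for [z], applied to
    [m] and [F n], forces [y] to be [F n]. *)
Lemma PA_value_form_functional G n y z :
  G ⊢ value_form Q y z (numeral n) -> G ⊢ fEq y (numeral (F n)).
Proof.
  intros H.
  destruct (proj1 (Q_graph n _) eq_refl) as (m & Lm & Hm).
  pose proof (entails_andE1 _ _ _ _ (entails_andE1 _ _ _ _ H)) as Hle.
  pose proof (entails_andE2 _ _ _ _ (entails_andE1 _ _ _ _ H)) as HQ.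
  apply entails_andE2 in H.
  eapply entails_orE; [apply (PA_le_total_numeral m z)| |].
  - eapply PA_le_numeralE; [apply entails_hyp; now left|].
    intros j G1 Hj I1 E1.
    assert (I : incl G G1) by (intros q Hq; apply I1; now right).
    apply (entails_weaken _ _ _ _ I) in Hle, HQ; clear I I1 H.
    apply (entails_eq_le _ _ _ _ _ _ (entails_eq_refl _ _ y) E1) in Hle.
    apply (PA_le_numeralE _ _ _ _ Hle); intros i G2 Hi I E2.
    apply (entails_weaken _ _ _ _ I) in HQ, E1.
    destruct (classic (sat (env3 i j n) Q)) as [S|S].
    + replace (F n) with i; [assumption|].
      apply Q_graph; exists j; auto.
    + apply entails_absurd with (fsubst (close (env3 i j n)) Q);
        [|now apply PA_nil, PA_delta0_complete].
      rewrite <- graph_form_numeral.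
      generalize (entails_eqE _ _ (graph_form Q (tVar 0) (tshift z)
        (numeral n)) _ _ E2).
      generalize (entails_eqE _ _ (graph_form Q (numeral i) (tVar 0)
        (numeral n)) _ _ E1).
      unfold inst; rewrite !fsubst_graph_form, !tsubst_numeral, !tinst_tshift.
      cbn; auto.
  - apply entails_eq_sym.
    apply (entails_weaken _ _ (fLe (numeral m) z :: G)) in H; [|now right].
    apply (entails_allE _ _ _ (numeral m)) in H; unfold inst in H; cbn in H.
    rewrite tinst_tshift in H.
    pose proof (entails_hyp PA (_ :: G) _ (in_eq (fLe (numeral m) z) G)) as L.
    apply (entails_impE _ _ _ _ H) in L; clear H; rename L into H.
    apply (entails_allE _ _ _ (numeral (F n))) in H; unfold inst in H.
    cbn in H; rewrite !fsubst_graph_form in H; cbn in H.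
    rewrite !tshift_numeral, !tsubst_up_tshift, !tinst_tshift,
      !tsubst_numeral in H.
    eapply entails_impE; [eapply entails_impE; [exact H|]|].
    + now apply PA_numeral_le.
    + rewrite graph_form_numeral; now apply PA_nil, PA_delta0_complete.
Qed.

(** The instance is a true Delta0 sentence; its uniqueness clause holds because every witnessed
    value in the standard model is [F n]. *)
Lemma PA_value_form_exists n : exists m, forall G,
  G ⊢ value_form Q (numeral (F n)) (numeral m) (numeral n).
Proof.
  destruct (proj1 (Q_graph n _) eq_refl) as (m & Lm & Hm).
  exists m; intros G; apply PA_nil.
  replace (value_form Q (numeral (F n)) (numeral m) (numeral n))
    with (fsubst (close (env3 (F n) m n))
            (value_form Q (tVar 0) (tVar 1) (tVar 2)))
    by apply fsubst_value_form.
  apply PA_delta0_complete; [now apply Delta0_value_form|].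
  assert (K : forall e y z x, sat e (graph_form Q y z x) <->
            sat (env3 (teval e y) (teval e z) (teval e x)) Q).
  { intros; unfold graph_form; rewrite sat_fsubst; apply sat_ext.
    now intros [|[|[|i]]]. }
  cbn -[env3]; repeat split; [exact Lm|now apply K|].
  intros z' _ y' L; rewrite K; cbn -[env3]; intros S.
  apply Q_graph; exists z'; split; assumption.
Qed.

End ValueForm.

Lemma gnum_iter_fEx k p :
  gnum (Nat.iter k fEx p) = Nat.iter k (fun c => node 7 c 0) (gnum p).
Proof. induction k as [|k IH]; cbn; [|f_equal]; auto. Qed.

Lemma Sigma1_iter_fEx p : Sigma1 p ->
  exists k d, Delta0 d /\ p = Nat.iter k fEx d.
Proof.
  induction 1 as [p D|p _ (k & d & D & ->)]; [now exists 0, p|].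
  now exists (S k), d.
Qed.

Lemma iter_fEx_Sigma1 k d : Delta0 d -> Sigma1 (Nat.iter k fEx d).
Proof.
  intros D; induction k as [|k IH]; [exact (S1_delta _ D)|exact (S1_ex _ IH)].
Qed.

Lemma form_below_iter_fEx k : forall j p,
  form_below j (Nat.iter k fEx p) <-> form_below (k + j) p.
Proof.
  induction k as [|k IH]; intros j p; [reflexivity|].
  rewrite Nat.iter_succ; cbn; rewrite IH; now rewrite Nat.add_succ_r.
Qed.

(* The prefix of quantifiers of [Pr] is kept in front, so that the fixed point
   is literally a block of existential quantifiers before a Delta0 matrix.  The
   equation [x = numeral n] replaces the substitution of [numeral n], which
   keeps the Goedel number a simple function of [n] and [tcode (numeral n)]. *)
Definition fixed_point_form (k n : nat) (M d : form) : form :=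
  Nat.iter (3 + k) fEx (fAnd (fAnd (fEq (tVar (2 + k)) (numeral n)) M) d).

Lemma sigma1_fixed_point th Pr : Sigma1 Pr -> form_below 1 Pr ->
  exists s, Sigma1 s /\ sentence s /\
    [] ⊢ fIff s (inst Pr (quote (fNeg (fImp th s)))).
Proof.
  intros HS HB; destruct (Sigma1_iter_fEx _ HS) as (k & d & Dd & EPr).
  (* The argument [n] occurs twice: through its numeral in the equation, and in place of the code of
     [M]. So [F] can be fixed before [M], and the choice [n := gnum M] below makes [F n] the code of
     [fNeg (fImp th s)]. *)
  set (F n := node 2 (node 5 (gnum th) (Nat.iter (3 + k)
    (fun c => node 7 c 0)
    (node 3 (node 3 (node 0 (tcode (tVar (2 + k))) (tcode (numeral n))) n)
            (gnum d)))) 0).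
  destruct (graph_delta0 F) as (Q & DQ & HQ).
  { unfold F; repeat first
      [ apply fun_def_node | apply fun_def_iter_node
      | apply fun_def_tcode_numeral ]; apply fun_def_term; term_def. }
  (* Variables below [k] belong to the prefix of [Pr]. Variable [k], the free variable of [Pr], is
     the computed value; the next two are its witness and the argument. *)
  set (M := value_form Q (tVar k) (tVar (1 + k)) (tVar (2 + k))).
  set (n := gnum M); set (s := fixed_point_form k n M d).
  assert (EF : quote (fNeg (fImp th s)) = numeral (F n)).
  { unfold quote, s, fixed_point_form; cbn [gnum].
    rewrite gnum_iter_fEx; reflexivity. }
  exists s; split; [|split].
  - apply iter_fEx_Sigma1; constructor;
      [constructor; [constructor|]|assumption].
    now apply Delta0_value_form.
  - apply form_below_iter_fEx; split;
      [split; [split; [cbn; lia|apply term_below_numeral]|]|].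
    + apply form_below_value_form; cbn; lia.
    + rewrite EPr, form_below_iter_fEx in HB.
      eapply form_below_mono, HB; lia.
  - rewrite EF; set (q := inst Pr (numeral (F n))).
    assert (Hq : fshift q = q).
    { apply fsubst_sentence, form_below_inst;
        [assumption|apply term_below_numeral]. }
    (* The conjuncts free of the variables bound in the prefix of [Pr], with indices lowered by [k];
       once they are pulled out, the rest is [Pr] itself. *)
    set (P := fAnd (fEq (tVar 2) (numeral n))
                (value_form Q (tVar 0) (tVar 1) (tVar 2))).
    assert (Es : s = fEx (fEx (fEx (Nat.iter k fEx
                  (fAnd (fsubst (fun i => tVar (i + k)) P) d))))).
    { unfold P; cbn [fsubst tsubst].
      rewrite fsubst_value_form, tsubst_numeral; reflexivity. }
    rewrite Es; apply entails_andI; apply entails_impI.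
    + eapply entails_cut.
      * do 3 apply (entails_ex_mono _ PA_sentences).
        apply (entails_iter_ex_andE _ PA_sentences), entails_hyp; now left.
      * rewrite <- EPr.
        eapply entails_weaken with (G := [fEx (fEx (fEx (fAnd P Pr)))]);
          [intros x; cbn; tauto|].
        do 3 (apply (entails_ex_elim _ PA_sentences); [assumption|]).
        match goal with |- ?G ⊢ _ => assert (H : G ⊢ fAnd P Pr)
          by (apply entails_hyp; now left) end.
        pose proof (entails_andE1 _ _ _ _ H) as HP; apply entails_andE2 in H.
        unfold q; eapply entails_eqE.
        { apply (PA_value_form_functional F Q DQ HQ _ n (tVar 0) (tVar 1)).
          pose proof (entails_andE1 _ _ _ _ HP) as HE.
          apply entails_andE2 in HP.
          (* Variable 0 marks the argument to be replaced by [numeral n]; instantiation lowers the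
             other two to 0 and 1. *)
          generalize (entails_eqE _ _ (value_form Q (tVar 1) (tVar 2) (tVar 0))
            _ _ HE); unfold inst; rewrite !fsubst_value_form; auto. }
        unfold inst; rewrite fsubst_below with (k := 1) (r := tVar);
          [now rewrite fsubst_id|assumption|].
        intros [|i] Hi; [reflexivity|lia].
    + destruct (PA_value_form_exists F Q DQ HQ n) as [m Hm].
      eapply entails_cut.
      (* Witnesses from the outermost quantifier inwards: the argument, the bound and the value. *)
      * apply (entails_ex3I _ _ (fAnd P Pr) (numeral n) (numeral m)
                 (numeral (F n))).
        unfold P; cbn -[value_form].
        rewrite fsubst_value_form, tsubst_numeral; cbn -[value_form].
        apply entails_andI;
          [apply entails_andI; [apply entails_eq_refl|apply Hm]|].
        rewrite (fsubst_below Pr 1 _ (scons (numeral (F n)) tVar));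
          [apply entails_hyp; now left|assumption|].
        intros [|i] Hi; [reflexivity|lia].
      * eapply entails_weaken with (G := [fEx (fEx (fEx (fAnd P Pr)))]);
          [intros x; cbn; tauto|].
        do 3 apply (entails_ex_mono _ PA_sentences).
        apply entails_cut with P;
          [eapply entails_andE1, entails_hyp; now left|].
        apply (entails_iter_ex_andI _ PA_sentences); [now left|].
        rewrite <- EPr; eapply entails_andE2, entails_hyp; right; now left.
Qed.

(** * Unprovability of consistency and failure of the Rosser condition *)

Lemma entails_proves T p : entails T [] p -> proves T p.
Proof. exact (fun H => H). Qed.

Lemma bigand_proves T l :
  (forall q, In q l -> proves T q) -> entails T [] (bigand l).
Proof.
  induction l as [|p [|q l] IH]; intros H.
  - apply entails_eq_refl.
  - apply H; now left.
  - apply entails_andI;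
      [apply H; now left|apply IH; intros; apply H; now right].
Qed.

Theorem corollary2p9 (S T : form -> Prop)
  (ceS : ce_theory S) (ceT : ce_theory T)
  (conS : consistent S) (conT : consistent T)
  (S_PA : stronger S PA) (T_PA : stronger T PA) (T_S : stronger T S)
  (Pr : form) (Pr_Sigma1 : Sigma1 Pr)
  (Pr_prov : provability_predicate S T Pr) :
  (cond_E S T Pr -> cond_C S Pr -> cond_D3 S Pr -> ~ proves T (ConL Pr)) /\
  (cond_C S Pr -> cond_Sigma1C_minus S T Pr -> ~ cond_Ros T Pr).
Proof.
  destruct Pr_prov as [HB HP].
  assert (W : forall p G, proves T p -> entails T G p)
    by (intros p G; apply (entails_weaken _ []); intros x []).
  assert (V : forall p G, proves S p -> entails S G p)
    by (intros p G; apply (entails_weaken _ []); intros x []).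
  assert (Triv : forall U p, entails U [] (fNeg (fAnd p (fNeg p)))).
  { intros U p; apply entails_negI with p;
      [eapply entails_andE1|eapply entails_andE2];
      apply entails_hyp; now left. }
  (* The common end of both parts: afterwards it is enough to refute [s] in [T]. *)
  assert (K : forall th s,
              [] ⊢ fIff s (inst Pr (quote (fNeg (fImp th s)))) ->
              proves T th -> proves T (fNeg s) -> False).
  { intros th s Hs Hth Hns; apply conT; exists s; split; [|assumption].
    apply T_S, entails_proves; eapply entails_impE;
      [eapply entails_andE2, S_PA, Hs|].
    apply HP, entails_proves, entails_negI with s; [|apply W, Hns].
    eapply entails_impE; [apply entails_hyp; now left|apply W, Hth]. }
  split.
  - intros HE HC H3 HCon.
    destruct (sigma1_fixed_point (fEq tZero tZero) Pr Pr_Sigma1 HB)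
      as (s & _ & _ & Hs).
    apply (K _ _ Hs); [apply (entails_eq_refl T [])|].
    set (g := fNeg (fImp (fEq tZero tZero) s)) in *.
    set (f := fEq tZero (tSucc tZero)).
    (* As the antecedent [0 = 0] is provable, [fNeg g] is equivalent to [s], and [s] to [Pr] of
       [g]. *)
    assert (T_not_g : entails T [] (fIff (inst Pr (quote g)) (fNeg g))).
    { pose proof (T_PA _ Hs) as HsT; apply entails_andI; apply entails_impI.
      - apply entails_negI with s.
        + eapply entails_impE; [eapply entails_andE2, W, HsT|].
          apply entails_hyp; right; now left.
        + apply entails_negI with (fImp (fEq tZero tZero) s);
            [|apply entails_hyp; right; now left].
          apply entails_impI, entails_hyp; right; now left.
      - eapply entails_impE; [eapply entails_andE1, W, HsT|].
        apply entails_impE with (fEq tZero tZero); [|apply entails_eq_refl].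
        apply entails_raa with g; apply entails_hyp;
          [now left|right; now left]. }
    assert (T_contra : entails T [] (fIff (fAnd g (fNeg g)) f)).
    { apply entails_andI; apply entails_impI.
      - eapply entails_absurd; [|apply W, Triv]; apply entails_hyp; now left.
      - eapply entails_absurd; [eapply entails_eq_sym, entails_hyp; now left|].
        apply W, T_PA, entails_proves, PA_succ_neq_zero. }
    (* From [Pr] of [g], D3 gives [Pr] of [Pr(g)], which E turns into [Pr] of [fNeg g]; C joins the
       two and E replaces the contradiction by [0 = 1]. *)
    assert (S_g : entails S [s] (inst Pr (quote f))).
    { assert (Hg : entails S [s] (inst Pr (quote g))).
      { eapply entails_impE; [eapply entails_andE1, V, S_PA, Hs|].
        apply entails_hyp; now left. }
      eapply entails_impE; [eapply entails_andE1, V, HE, T_contra|].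
      eapply entails_impE; [apply V, HC|]; apply entails_andI; [exact Hg|].
      eapply entails_impE; [eapply entails_andE1, V, HE, T_not_g|].
      eapply entails_impE; [apply V, H3|exact Hg]. }
    apply entails_proves, entails_negI with (inst Pr (quote f));
      [|apply W, HCon].
    eapply entails_impE; [|apply entails_hyp; now left].
    apply W, T_S, entails_proves, entails_impI; exact S_g.
  - intros HC (T0 & _ & HT0 & H1) HRos; set (th := bigand T0) in *.
    assert (Hth : proves T th)
      by (apply bigand_proves; intros q Hq; now apply HT0).
    destruct (sigma1_fixed_point th Pr Pr_Sigma1 HB)
      as (s & Ss & Sent & Hs).
    apply (K _ _ Hs); [assumption|].
    (* In this part [g] is the implication itself, so [s] yields [Pr] of [g] by the completeness
       condition and [Pr] of [fNeg g] by the fixed point. *)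
    set (g := fImp th s) in *.
    assert (S_g : entails S [s] (inst Pr (quote (fAnd g (fNeg g))))).
    { eapply entails_impE; [apply V, HC|]; apply entails_andI;
        (eapply entails_impE; [|apply entails_hyp; now left]).
      - apply V, H1; assumption.
      - eapply entails_andE1, V, S_PA, Hs. }
    apply entails_proves, entails_negI with (inst Pr (quote (fAnd g (fNeg g)))).
    + eapply entails_impE; [|apply entails_hyp; now left].
      apply W, T_S, entails_proves, entails_impI; exact S_g.
    + apply W, HRos, Triv.
Qed.
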